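(* Let $n$ be a positive integer, $m=\lceil (4n-11)/9\rceil$, and let $(u_k)$ be the sequence of integers defined by $$u_{m-1}=3\binom{m+1}{2}+3\binom{m+1-\lfloor n/3\rfloor}{2}-3\Bigl(m-\Bigl\lfloor \frac n3\Bigr\rfloor\Bigr)\Bigl(\frac n3-\Bigl\lfloor\frac n3\Bigr\rfloor\Bigr)$$ and $$u_k=\left\lceil \frac{1}{n-2k-2}\left(\binom n2+(n-2k-3)\,u_{k-1}\right)\right\rceil\qquad\text{for } k\ge m .$$ Then for every integer $k$ such that $m-1\le k\le (n-3)/2$, $$E_{\le k}(n)\ge u_k .$$
   Context: All point sets are finite, in the plane, and in general position (no three collinear). For a set $P$ of $n$ points and an integer $0\le k\le n/2-1$, a $k$-edge of $P$ is a line through two points of $P$ leaving exactly $k$ points of $P$ on one side; $E_k(P)$ is the number of $k$-edges of $P$ and $E_{\le k}(P)=\sum_{j=0}^k E_j(P)$. $E_{\le k}(n)$ is the minimum of $E_{\le k}(P)$ over all sets $P$ of $n$ points in general position in the plane; it is considered only for $0\le k\le n/2-1$. The recursion for $u_k$ is used only for $k\le (n-3)/2$, so that $n-2k-2>0$. *)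

(* Defs.v *)
From HB Require Import structures.
From mathcomp Require Import all_boot all_order all_algebra.
From mathcomp Require Import finmap.
From mathcomp Require Import boolp classical_sets reals.
From mathcomp Require Import zify ring lra.

Set Implicit Arguments.
Unset Strict Implicit.
Unset Printing Implicit Defensive.

Import Order.TTheory GRing.Theory Num.Theory.

Local Open Scope ring_scope.
Local Open Scope fset_scope.

Section PointSets.
Variable R : realType.
Implicit Types (p q r : R * R) (P : {fset R * R}).

(* Twice the signed area of the triangle pqr: null iff p, q, r are collinear,
   and, for p != q, its sign tells on which side of the line pq the point r
   lies. *)
Definition orient p q r : R :=
  (q.1 - p.1) * (r.2 - p.2) - (q.2 - p.2) * (r.1 - p.1).

Definition line p q : set (R * R) := [set r | orient p q r = 0]%classic.

Definition general_position P : Prop :=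
  forall p q r, p \in P -> q \in P -> r \in P ->
    p != q -> q != r -> p != r -> ~ line p q r.

Definition left_pts P p q : {fset R * R} := [fset r in P | 0 < orient p q r].
Definition right_pts P p q : {fset R * R} := [fset r in P | orient p q r < 0].

(* The set is made of lines, not of pairs of points: the pairs (p, q) and
   (q, p) contribute the same element. *)
Definition kedges (k : nat) P : {fset set (R * R)} :=
  [fset line e.1 e.2 | e in P `*` P
     & [&& e.1 != e.2
         & (#|` left_pts P e.1 e.2| == k) || (#|` right_pts P e.1 e.2| == k)]].

Definition E (k : nat) P : nat := #|` kedges k P|.

(* The sum of E j P over 0 <= j <= k, which is empty when k < 0. *)
Definition Ele (k : int) P : nat :=
  match k with
  | Posz k' => (\sum_(0 <= j < k'.+1) E j P)%N
  | Negz _ => 0%N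
  end.

Definition Ele_value (n : nat) (k : int) : pred nat := fun e =>
  `[< exists P, [/\ #|` P| = n, general_position P & Ele k P = e] >].

(* n points on the parabola y = x ^ 2 are in general position. *)
Lemma Ele_value_ex n k : exists e, Ele_value n k e.
Proof.
pose f (i : nat) : R * R := (i%:R, i%:R ^+ 2).
have f_inj : injective f by move=> i j [/eqP]; rewrite eqr_nat => /eqP.
pose P := [fset x | x in map f (iota 0 n)].
have PE x : x \in P -> exists i, x = f i.
  by rewrite !inE /= => /mapP[i _ ->]; exists i.
exists (Ele k P); apply/asboolP; exists P; split=> //.
  rewrite card_fseq undup_id ?size_map ?size_iota //.
  by rewrite map_inj_uniq ?iota_uniq.
move=> p q r /PE[a ->] /PE[b ->] /PE[c ->].
rewrite !(inj_eq f_inj) -!(eqr_nat R) => ab bc ac.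
rewrite /line /orient /= => h.
have : (b%:R - a%:R) * (c%:R - a%:R) * (c%:R - b%:R) = 0 :> R.
  by rewrite -h; ring.
move/eqP; rewrite !mulf_eq0 !subr_eq0.
by rewrite (eq_sym b%:R) (negPf ab) eq_sym (negPf ac) eq_sym (negPf bc).
Qed.

Definition Ele_min (n : nat) (k : int) : nat := ex_minn (Ele_value_ex n k).

End PointSets.

Arguments Ele_min : clear implicits.

Definition mstart (n : nat) : int := Num.ceil ((4 * n%:R - 11) / 9 : rat).

(* `|a| is a itself when 0 <= a; this holds at the two arguments used for the
   sequence u, by mstart_ge0 and mstart_ge3 below. *)
Definition binz2 (a : int) : rat := 'C(`|a|%N, 2)%:R.

Lemma mstart_ge3 n : (0 < n)%N -> (n %/ 3)%N%:Z <= mstart n.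
Proof.
move=> n0; have : (((n %/ 3)%N%:Z - 1) * 9 < 4 * n%:Z - 11) by lia.
rewrite -(ltr_int rat) => h.
have h' : ((n %/ 3)%N%:Z - 1)%:~R < (4 * n%:R - 11) / 9 :> rat.
  rewrite ltr_pdivlMr //; move: h.
  by rewrite !rmorphM !rmorphB /= !rmorphM.
have := lt_le_trans h' (ceil_ge _).
by rewrite ltr_int -/(mstart n); lia.
Qed.

Lemma mstart_ge0 n : (0 < n)%N -> 0 <= mstart n.
Proof. by move=> /mstart_ge3; apply: le_trans. Qed.

(* Main.v *)
Require Import Defs.
From mathcomp Require Import all_boot all_order all_algebra.
From mathcomp Require Import finmap.
From mathcomp Require Import boolp reals.
From mathcomp Require Import zify ring lra.

(** A direction that rotates by a half turn meets the points of P in varying orders: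
    two neighbours are swapped at a time, and every pair is swapped once. The line
    through x and y is a k-edge iff the swap of x and y takes place at rank k, counted
    from the front or from the back. So E_{<= k} counts the swaps of rank below
    K = k + 1 from one of the two ends, and the theorem follows from two properties of
    such circular sequences of orders.

    The first one gives the initial value of the recursion: for 2 K < n, at least
    3 C(K + 1, 2) + sum_{j <= K} max (0, 3 j - n) swaps have rank below K
    (low_flips_lb). The proof is by induction on n. A vertex of the convex hull is
    among the first K points for an interval of directions, its arc, that is shorter
    than a half turn, and it takes part in 2 K of the swaps. If two vertices have
    disjoint arcs, they are removed, and K drops by 1 (low_flips_two). Otherwise, three
    vertices have arcs that cover the circle without a common point (arc_select).
    They are removed, K drops by 2, and 3 K - n further swaps are found at the
    directions at which only one of the three is among the first K (low_flips_three).

    The second one gives the recursion. Let w = n - 2 K. The swaps inside the window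
    of the w central positions number C(n, 2) - E_{<= k}, and the swaps at its border
    number E_k. A point that enters the window swaps with at most w - 1 others before
    it leaves, so a swap inside the window can be charged to the last entrance of one
    of its points, unless both points stay in the window for ever. It follows
    (window_flips) that the number of swaps inside is at most (w - 1) E_k, or else at
    most n (w - 1). The first alternative is the inequality
    w E_{<= k} >= C(n, 2) + (w - 1) E_{<= k - 1}, which is the recursion for u. The
    second alternative gives more than is needed, since u_k <= C(n, 2) - n (w - 1): this
    bound is preserved by the recursion (recursion_bound), and the initial value
    satisfies a sufficient form of it because m is close to 4 n / 9 (start_gap). *)

Set Implicit Arguments.
Unset Strict Implicit.
Unset Printing Implicit Defensive.

(** * Circular sequences *)

(** The orders in which a rotating direction meets a point set; the direction
    at time t + T is opposite to the one at time t. A step may swap nothing,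
    so that the restriction to fewer points is again such a sequence on the
    same time axis. The last clause says that a pair swaps exactly once in T
    consecutive steps. *)
Record circular (V : finType) (T : nat) (bef : nat -> rel V) : Prop := Circular {
  bef_irr : forall t x, bef t x x = false;
  bef_trans : forall t x y z, bef t x y -> bef t y z -> bef t x z;
  bef_total : forall t x y, x != y -> bef t x y || bef t y x;
  bef_anti : forall t x y, bef (t + T) x y = bef t y x;
  bef_single : forall t x y z w, bef t x y -> bef t.+1 y x ->
    bef t z w -> bef t.+1 w z -> x = z /\ y = w;
  bef_convex : forall s u t x y, s <= u -> u <= t -> t <= s + T ->
    bef s x y -> bef t x y -> bef u x y }.

Section Circular.
Variables (V : finType) (T : nat) (bef : nat -> rel V).
Hypothesis C : circular T bef.
Implicit Types (S : {set V}) (t s u : nat) (x y z v : V) (K r : nat).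

Definition flip t x y := bef t x y && bef t.+1 y x.
Definition rank S t x := #|[set z in S | bef t z x]|.

Lemma bef_asym t x y : bef t x y -> bef t y x = false.
Proof.
move=> h; apply/negP=> h'; have := bef_trans C h h'.
by rewrite (bef_irr C).
Qed.

Lemma befN t x y : x != y -> bef t y x = ~~ bef t x y.
Proof.
move=> xy; have := bef_total C t xy.
by case h: (bef t x y); rewrite ?(bef_asym h).
Qed.

Lemma bef_neq t x y : bef t x y -> x != y.
Proof. by apply: contraTneq => ->; rewrite (bef_irr C). Qed.

Lemma flip_neq t x y : flip t x y -> x != y.
Proof. by case/andP => /bef_neq. Qed.

Lemma flipxx t x : flip t x x = false.
Proof. by rewrite /flip (bef_irr C). Qed.

Lemma flip_single t x y z w : flip t x y -> flip t z w -> x = z /\ y = w.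
Proof. by case/andP=> a b /andP[c d]; apply: (bef_single C a b c d). Qed.

Lemma bef_stay t x y z w : flip t x y -> (z, w) != (x, y) -> (w, z) != (x, y) ->
  bef t.+1 z w = bef t z w.
Proof.
move=> f zw wz; case: (eqVneq z w) => [->|n]; first by rewrite !(bef_irr C).
case h: (bef t z w).
  apply/negP=> /negP h'; have h2 : flip t z w by rewrite /flip h (befN _ n).
  by case: (flip_single f h2) => e1 e2; rewrite e1 e2 eqxx in zw.
apply/negP=> h'; have h2 : flip t w z by rewrite /flip h' (befN _ n) h.
by case: (flip_single f h2) => e1 e2; rewrite e1 e2 eqxx in wz.
Qed.

(** A step changes the order of one pair only, so no element can lie between
    the two that swap. *)
Lemma flip_adj t x y z : flip t x y -> z != x -> z != y -> bef t z x = bef t z y.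
Proof.
move=> f zx zy; case/andP: (f) => a b.
case h: (bef t z x); first by rewrite (bef_trans C h a).
apply/esym/negP=> h'.
have n1: bef t.+1 z x = false.
  by rewrite (bef_stay f) ?h // xpair_eqE ?(negPf zx) ?(negPf zy) ?andbF.
have n2: bef t.+1 z y.
  by rewrite (bef_stay f) ?h' // xpair_eqE ?(negPf zx) ?(negPf zy) ?andbF.
by rewrite (bef_trans C n2 b) in n1.
Qed.

Lemma bef2T t x y : bef (t + 2 * T) x y = bef t x y.
Proof. by rewrite mul2n -addnn addnA !(bef_anti C). Qed.

Lemma flipT t x y : flip (t + T) x y = flip t y x.
Proof. by rewrite /flip -addSn !(bef_anti C). Qed.

Lemma flip2T t x y : flip (t + 2 * T) x y = flip t x y.
Proof. by rewrite mul2n -addnn addnA !flipT. Qed.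

Lemma rank2T S t x : rank S (t + 2 * T) x = rank S t x.
Proof. by apply: eq_card => z; rewrite !inE bef2T. Qed.

Lemma rankD S t x : x \in S -> rank S (t + T) x + rank S t x = #|S|.-1.
Proof.
move=> xS; rewrite (cardsD1 x S) xS /= /rank -cardsUI.
rewrite (_ : _ :&: _ = set0) ?cards0 ?addn0; last first.
  apply/setP=> z; rewrite !inE (bef_anti C).
  by case h: (bef t x z); rewrite ?(bef_asym h) !andbF.
apply: eq_card => z; rewrite !inE (bef_anti C) -andb_orr.
case: (eqVneq z x) => [->|n]; first by rewrite (bef_irr C) andbF.
by rewrite orbC (bef_total C) // andbT.
Qed.

Lemma rank_lt S t x : x \in S -> rank S t x < #|S|.
Proof.
move=> xS; apply: proper_card; apply/properP; split.
  by apply/subsetP=> z; rewrite inE => /andP[].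
by exists x; rewrite // inE (bef_irr C) andbF.
Qed.

Lemma bef_rank S t x y : x \in S -> bef t x y -> rank S t x < rank S t y.
Proof.
move=> xS h; apply: proper_card; apply/properP; split.
  apply/subsetP=> z; rewrite !inE => /andP[-> /= zx]; exact: (bef_trans C zx h).
by exists x; rewrite inE ?xS ?h // (bef_irr C).
Qed.

Lemma rank_bef S t x y : y \in S -> rank S t x < rank S t y -> bef t x y.
Proof.
move=> yS h; case: (eqVneq x y) => [e|n]; first by rewrite e ltnn in h.
apply/negPn/negP; rewrite -(befN _ n) => /(bef_rank yS); lia.
Qed.

Lemma rank_inj S t x y : x \in S -> y \in S -> rank S t x = rank S t y -> x = y.
Proof.
move=> xS yS e; apply/eqP/negPn/negP=> n.
by case/orP: (bef_total C t n) => /bef_rank h; [have := h S xS|have := h S yS]; rewrite e ltnn.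
Qed.

Lemma rank_flip S t x y : x \in S -> y \in S -> flip t x y ->
  [/\ rank S t y = (rank S t x).+1, rank S t.+1 x = (rank S t x).+1
    & rank S t.+1 y = rank S t x].
Proof.
move=> xS yS f; case/andP: (f) => a b; have n := flip_neq f.
have e z : z != x -> z != y ->
    (bef t z y = bef t z x) * (bef t.+1 z x = bef t z x) * (bef t.+1 z y = bef t z x).
  move=> zx zy; rewrite (flip_adj f zx zy).
  by rewrite !(bef_stay f) ?(flip_adj f zx zy) // xpair_eqE ?(negPf zx) ?(negPf zy) ?andbF.
have n' := n; rewrite eq_sym in n'.
split.
- rewrite /rank [LHS](cardsD1 x) !inE xS a /= add1n; congr _.+1.
  apply: eq_card => z; rewrite !inE.
  case: (eqVneq z x) => [->|zx]; first by rewrite (bef_irr C) andbF.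
  case: (eqVneq z y) => [->|zy]; first by rewrite (bef_irr C) (bef_asym a).
  by rewrite e.
- rewrite /rank [LHS](cardsD1 y) !inE yS b /= add1n; congr _.+1.
  apply: eq_card => z; rewrite !inE.
  case: (eqVneq z y) => [->|zy]; first by rewrite (bef_asym a) andbF.
  case: (eqVneq z x) => [->|zx]; first by rewrite !(bef_irr C).
  by rewrite e.
- apply: eq_card => z; rewrite !inE.
  case: (eqVneq z y) => [->|zy]; first by rewrite (bef_irr C) (bef_asym a).
  case: (eqVneq z x) => [->|zx]; first by rewrite (bef_irr C) (bef_asym b).
  by rewrite e.
Qed.

Lemma rank_cases S t z : z \in S ->
  [\/ rank S t.+1 z = rank S t z, exists2 y, y \in S & flip t z y
    | exists2 y, y \in S & flip t y z].
Proof.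
move=> zS.
case: (pickP [pred y in S | flip t z y]) => [y /andP[yS f]|n1].
  by constructor 2; exists y.
case: (pickP [pred y in S | flip t y z]) => [y /andP[yS f]|n2].
  by constructor 3; exists y.
constructor 1; apply: eq_card => y; rewrite !inE.
case yS: (y \in S) => //=.
case: (eqVneq y z) => [->|n]; first by rewrite !(bef_irr C).
have := n1 y; have := n2 y; rewrite /= yS /flip /=.
rewrite (befN t n) (befN t.+1 n).
by case: (bef t y z); case: (bef t.+1 y z).
Qed.

(** A swap moves a rank by one, so an element that rises above the level r
    swaps exactly at rank r. *)
Lemma rank_step_up S t z r : z \in S -> rank S t z <= r -> r < rank S t.+1 z ->
  exists2 y, y \in S & flip t z y /\ rank S t z = r.
Proof.
move=> zS h1 h2; case: (rank_cases t zS) => [e|[y yS f]|[y yS f]].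
- lia.
- by exists y => //; split=> //; case: (rank_flip zS yS f); lia.
- case: (rank_flip yS zS f); lia.
Qed.

Lemma rank_step_down S t z r : z \in S -> rank S t.+1 z <= r -> r < rank S t z ->
  exists2 y, y \in S & [/\ flip t y z, rank S t y = r & rank S t z = r.+1].
Proof.
move=> zS h1 h2; case: (rank_cases t zS) => [e|[y yS f]|[y yS f]].
- lia.
- case: (rank_flip zS yS f); lia.
- by exists y => //; case: (rank_flip yS zS f); split=> //; lia.
Qed.

Lemma rank_up S s t z r : z \in S -> s <= t -> rank S s z <= r -> r < rank S t z ->
  exists2 u, s <= u < t & exists2 y, y \in S & flip u z y /\ rank S u z = r.
Proof.
move=> zS; elim: t => [|t IH] st h1 h2; first by move: st h1 h2; rewrite leqn0 => /eqP -> h1 h2; lia.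
case: (leqP (rank S t z) r) => h.
  case: (ltngtP s t.+1) st => // [st _|e _]; last by rewrite -e in h2; lia.
  have [y yS f] := rank_step_up zS h h2.
  by exists t; [lia|exists y].
case: (ltngtP s t.+1) st => // [st _|e _]; last by rewrite -e in h2; lia.
case: IH => // [u hu f]; exists u => //; lia.
Qed.

Lemma rank_down S s t z r : z \in S -> s <= t -> rank S t z <= r -> r < rank S s z ->
  exists2 u, s <= u < t & exists2 y, y \in S & flip u y z /\ rank S u y = r.
Proof.
move=> zS; elim: t => [|t IH] st h1 h2; first by move: st h1 h2; rewrite leqn0 => /eqP -> h1 h2; lia.
case: (ltnP r (rank S t z)) => h.
  case: (ltngtP s t.+1) st => // [st _|e _]; last by rewrite -e in h1; lia.
  have [y yS [f f' _]] := rank_step_down zS h1 h.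
  by exists t; [lia|exists y].
case: (ltngtP s t.+1) st => // [st _|e _]; last by rewrite -e in h1; lia.
case: IH => // [u hu f]; exists u => //; lia.
Qed.

Lemma ex_first S t : 0 < #|S| -> exists2 v, v \in S & rank S t v = 0.
Proof.
case/card_gt0P=> x0 x0S; case: (arg_minnP (rank S t) x0S) => v vS hv.
exists v => //; apply/eqP; rewrite -leqn0 leqNgt; apply/negP.
case/card_gt0P=> z; rewrite inE => /andP[zS /(bef_rank zS)].
by have := hv z zS; lia.
Qed.

Lemma T_gt0 S : 1 < #|S| -> 0 < T.
Proof.
case/card_gt1P=> x [y [_ _ n]]; case: (posnP T) => // T0.
by have := bef_anti C 0 x y; rewrite T0 addn0 (befN 0 n); case: (bef 0 x y).
Qed.

Definition sflip t x y := flip t x y || flip t y x.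

Lemma sflipT t x y : sflip (t + T) x y = sflip t x y.
Proof. by rewrite /sflip !flipT orbC. Qed.

(** The pair has the same order right after its first swap and, by
    antisymmetry, at time t + T; convexity gives the same order at all times
    in between. *)
Lemma sflip_gap t t' x y : sflip t x y -> sflip t' x y -> t < t' -> t + T <= t'.
Proof.
wlog f : x y / flip t x y => [W /orP[h|h]|_ f' tt'].
- by apply: W => //; rewrite /sflip h.
- by rewrite /sflip orbC; apply: W => //; rewrite /sflip h.
rewrite leqNgt; apply/negP=> lt; case/andP: f => a b.
have h u : t < u -> u <= t + T -> bef u y x.
  move=> h1 h2; have h3 : bef (t + T) y x by rewrite (bef_anti C).
  apply: (bef_convex C h1 h2 _ b h3); lia.
move: f'; rewrite /sflip /flip.
have h1 := h t' tt' (ltnW lt); have h2 := h t'.+1 (leqW tt') lt.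
by rewrite (bef_asym h1) (bef_asym h2) andbF.
Qed.

Lemma sum_period (f : nat -> nat) P t0 : (forall t, f (t + P) = f t) ->
  \sum_(t0 <= t < t0 + P) f t = \sum_(0 <= t < P) f t.
Proof.
move=> per; elim: t0 => [|t0 IH]; first by rewrite add0n.
rewrite -IH; case: (posnP P) => [->|P0]; first by rewrite !addn0 !big_geq.
have h : t0 < t0 + P by lia.
rewrite [RHS](big_ltn h) addSn big_nat_recr /=; last by lia.
by rewrite per addnC.
Qed.

Lemma sum_bool_le1 (f : nat -> bool) s t :
  (forall u u', s <= u -> u < u' -> u' < t -> f u -> f u' -> False) ->
  \sum_(s <= u < t) f u <= 1.
Proof.
elim: t => [|t IH] h; first by rewrite big_geq.
case: (leqP s t) => st; last by rewrite big_geq.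
rewrite big_nat_recr //=; case ft: (f t); last first.
  by rewrite addn0; apply: IH => u u' a b c; apply: h => //; lia.
rewrite big_nat big1 // => u /andP[a b]; case fu: (f u) => //.
by case: (h u t).
Qed.

Lemma sum_ge1 (f : nat -> nat) s t u : s <= u < t -> 0 < f u -> 0 < \sum_(s <= i < t) f i.
Proof.
move=> h h'; rewrite (bigD1_seq u) ?mem_index_iota ?iota_uniq //=; lia.
Qed.

(** * Extreme elements and their arcs *)

(** For the orders of a point set, these are the vertices of the convex hull. *)
Definition extreme S v := exists f, rank S f v = 0.

Lemma first_bef S f v z : rank S f v = 0 -> z \in S -> z != v -> bef f v z.
Proof.
move=> r0 zS n; rewrite (befN f n); apply/negP=> h.
by have := bef_rank zS h; rewrite r0.
Qed.

Lemma last_bef S l v z : rank S (l + T) v = 0 -> z \in S -> z != v -> bef l z v.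
Proof. by move=> r0 zS n; rewrite -(bef_anti C); apply: first_bef r0 zS n. Qed.

Lemma rank_mono S t u v : (forall z, z \in S -> z != v -> bef t z v -> bef u z v) ->
  rank S t v <= rank S u v.
Proof.
move=> h; apply: subset_leq_card; apply/subsetP=> z; rewrite !inE => /andP[zS b].
by rewrite zS /= h // (bef_neq b).
Qed.

(** An element that is behind v once v is first gets in front of v by one
    swap, and the next swap of this pair is T steps later. So v only moves
    back while it goes from the first position to the last, and only forward
    on its return; this and the three following lemmas are the four ways in
    which this is used. *)
Lemma rank_from_first S v f u s : rank S f v = 0 -> f <= u -> u <= s -> s <= f + T ->
  rank S u v <= rank S s v.
Proof.
move=> r0 h1 h2 h3; apply: rank_mono => z zS n b; apply: contraT => b'.
rewrite -(befN _ n) in b'.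
by rewrite (bef_asym (bef_convex C h1 h2 h3 (first_bef r0 zS n) b')) in b.
Qed.

Lemma rank_to_first S v f u s : rank S f v = 0 -> s <= u -> u <= f -> f <= s + T ->
  rank S u v <= rank S s v.
Proof.
move=> r0 h1 h2 h3; apply: rank_mono => z zS n b; apply: contraT => b'.
rewrite -(befN _ n) in b'.
by rewrite (bef_asym (bef_convex C h1 h2 h3 b' (first_bef r0 zS n))) in b.
Qed.

Lemma rank_from_last S v l u s : rank S (l + T) v = 0 -> l <= u -> u <= s -> s <= l + T ->
  rank S s v <= rank S u v.
Proof.
move=> r0 h1 h2 h3; apply: rank_mono => z zS n b.
exact: (bef_convex C h1 h2 h3 (last_bef r0 zS n) b).
Qed.

Lemma rank_to_last S v l u s : rank S (l + T) v = 0 -> s <= u -> u <= l -> l <= s + T ->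
  rank S s v <= rank S u v.
Proof.
move=> r0 h1 h2 h3; apply: rank_mono => z zS n b.
exact: (bef_convex C h1 h2 h3 b (last_bef r0 zS n)).
Qed.

Lemma periodic_shift (P : nat -> Prop) p f s : 0 < p -> (forall t, P (t + p) <-> P t) ->
  P f -> exists2 f', s <= f' < s + p & P f'.
Proof.
move=> p0 per Pf; have perq q t : P (t + q * p) <-> P t.
  elim: q => [|q IH]; first by rewrite addn0.
  by rewrite (_ : t + _ = t + q * p + p) ?per // mulSn; lia.
have sp : s <= f + s * p by apply: leq_trans (leq_addl _ _); rewrite leq_pmulr.
exists (s + (f + s * p - s) %% p); first by have := ltn_pmod (f + s * p - s) p0; lia.
apply/(perq ((f + s * p - s) %/ p)).
by rewrite -addnA [_ %% _ + _]addnC -divn_eq subnKC // perq.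
Qed.

Lemma extreme_shift S v s : 0 < T -> extreme S v ->
  exists2 f, s <= f < s + 2 * T & rank S f v = 0.
Proof.
move=> T0 [f rf]; have p0 : 0 < 2 * T by lia.
apply: (periodic_shift (P := fun f => rank S f v = 0) s p0 _ rf) => t.
by rewrite rank2T.
Qed.

(** The rank of v falls until v is first and rises until it is last. Between
    two times at which the rank is below K, it can reach K only by a passage
    through the last position. As rank S (s + T) v is #|S| - 1 - rank S s v,
    which is at least K, such a passage is not over at time s + T. *)
Lemma rank_in_convex S K v s u t : v \in S -> extreme S v -> 0 < T -> 2 * K < #|S| ->
  s <= u -> u <= t -> t <= s + T -> rank S s v < K -> rank S t v < K -> rank S u v < K.
Proof.
move=> vS ev T0 K2 su ut ts rs rt; have [f /andP[h1 h2] rf] := extreme_shift s T0 ev.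
case: (leqP f t) => ft.
  case: (leqP u f) => uf.
    apply: leq_ltn_trans rs; apply: rank_to_first rf su uf _; lia.
  apply: leq_ltn_trans rt; apply: (rank_from_first rf (ltnW uf) ut); lia.
case: (leqP f (s + T)) => fs.
  by apply: leq_ltn_trans rs; apply: (rank_to_first rf su _ fs); lia.
have fE : f = f - T + T by lia.
rewrite fE in rf; case: (leqP (f - T) t) => lt.
  have := rank_from_last rf lt ts _; have := rankD s vS; lia.
by apply: leq_ltn_trans rt; apply: rank_to_last rf ut _ _; lia.
Qed.

Lemma rank_step S t z : z \in S ->
  rank S t.+1 z <= (rank S t z).+1 /\ rank S t z <= (rank S t.+1 z).+1.
Proof.
move=> zS; case: (rank_cases t zS) => [->|[y yS f]|[y yS f]]; first by split; lia.
  by case: (rank_flip zS yS f) => _ -> _; split; lia.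
by case: (rank_flip yS zS f) => -> _ ->; split; lia.
Qed.

(** A maximal interval of times during which v is among the first K elements,
    with both ends excluded, so that v has rank exactly K at o and at e. *)
Definition arc S K v o e := [/\ o < e <= o + T, rank S o v = K, rank S e v = K,
  (forall u, o < u < e -> rank S u v < K) & (forall u, e <= u <= o + 2 * T -> K <= rank S u v)].

Lemma arc_ex S K v t : v \in S -> extreme S v -> 0 < T -> 2 * K < #|S| ->
  T <= t -> rank S t v < K -> exists o e, arc S K v o e /\ o < t < e.
Proof.
move=> vS ev T0 K2 Tt rt.
have out u : rank S u v < K -> K <= rank S (u + T) v by move=> h; have := rankD u vS; lia.
have exe : exists e, (t < e) && (K <= rank S e v) by exists (t + T); rewrite out //; lia.
have exo : exists o, (o < t) && (K <= rank S o v).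
  exists (t - T); have := rankD (t - T) vS; rewrite subnK //; lia.
case: (ex_minnP exe) => e /andP[te re] mine.
have ubo o : (o < t) && (K <= rank S o v) -> o <= t by case/andP => /ltnW.
case: (ex_maxnP exo ubo) => o /andP[ot ro] maxo.
have inn u : o < u < e -> rank S u v < K.
  move=> h; rewrite ltnNge; apply/negP=> h'.
  case: (ltngtP u t) => [ut|tu|e0]; last by rewrite e0 in h'; lia.
    by have := maxo u; rewrite ut h' => /(_ isT); lia.
  by have := mine u; rewrite tu h' => /(_ isT); lia.
have roK : rank S o v = K.
  by have := inn o.+1 _; have [] := rank_step o vS; lia.
have reK : rank S e v = K.
  by have := inn e.-1 _; have [] := rank_step e.-1 vS; rewrite prednK; lia.
have eo : e <= o + T.
  rewrite leqNgt; apply/negP=> h; have := inn (o + T) _; have := rankD o vS; lia.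
exists o, e; split; last by lia.
split=> //; first by lia.
move=> u /andP[eu uo]; rewrite leqNgt; apply/negP=> ru.
case: (leqP u (t + T)) => h.
  by have := rank_in_convex vS ev T0 K2 (ltnW te) eu h rt ru; lia.
have rt2 : rank S (t + 2 * T) v < K by rewrite rank2T.
have := rank_in_convex vS ev T0 K2 uo _ _ ru rt2; rewrite rank2T; lia.
Qed.

Lemma arc_first S K v o e : 0 < T -> 0 < K -> extreme S v -> arc S K v o e ->
  exists2 f, o < f < e & rank S f v = 0.
Proof.
move=> T0 K0 ev [h1 h2 h3 h4 h5]; have [f /andP[h6 h7] rf] := extreme_shift o T0 ev.
exists f => //; have := h5 f; case: (eqVneq f o) => [fo|]; first by rewrite fo in rf; lia.
lia.
Qed.

(** At some moment of the arc v is first, so y was overtaken by v; it cannot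
    be in front of v again before T steps have passed. *)
Lemma arc_disjoint S K v o e y : 0 < T -> 0 < K -> extreme S v -> arc S K v o e ->
  y \in S -> bef o y v -> bef e y v -> False.
Proof.
move=> T0 K0 ev a yS h1 h2; have [f /andP[of_ fe] rf] := arc_first T0 K0 ev a.
case: a => /andP[_ eo] _ _ _ _.
have := bef_convex C (ltnW of_) (ltnW fe) eo h1 h2 => /(bef_rank yS); lia.
Qed.

(** A greedy covering of the circle of times. Start from the arc of any a.
    Among the arcs that contain its end, let b have the one that reaches
    furthest, and let the arc of c contain the end of that one. By the choice
    of b, the arc of c does not contain the end of the arc of a. So either c
    and a have disjoint arcs, or the arc of c runs into the next arc of a, at
    oa + 2 * T. The other inequalities hold because an arc is shorter than T:
    two arcs never cover the circle. *)
Lemma arc_select S K : 0 < T -> 0 < K -> 2 * K < #|S| ->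
  (exists a c, [/\ a \in S, c \in S, extreme S a, extreme S c
     & forall t, rank S t a < K -> rank S t c < K -> False]) \/
  (exists a b c oa ea ob eb oc ec,
     [/\ [/\ a \in S, b \in S & c \in S], [/\ extreme S a, extreme S b & extreme S c],
         [/\ arc S K a oa ea, arc S K b ob eb & arc S K c oc ec],
         [/\ ob < ea, ea <= oc & oc < eb] & [/\ eb <= oa + 2 * T, oa + 2 * T < ec & ec <= ob + 2 * T]]).
Proof.
move=> T0 K0 K2; have S0 : 0 < #|S| by lia.
have [a aS ra] := ex_first (4 * T) S0.
have ea0 : extreme S a by exists (4 * T).
have [||oa [ea [arca /andP[oat tea]]]] := @arc_ex S K a (4 * T) aS ea0 T0 K2; [lia|lia|].
(* d measures how far beyond the end ea of the first arc the arc of v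
   reaches. *)
pose Q d v := [/\ v \in S, extreme S v & forall u, ea <= u <= ea + d -> rank S u v < K].
have exQ : exists d, `[< exists v, Q d v >].
  have [b bS rb] := ex_first ea S0; exists 0; apply/asboolP; exists b; split=> //; first by exists ea.
  by move=> u h; rewrite (_ : u = ea) ?rb //; lia.
have ubQ d : `[< exists v, Q d v >] -> d <= T.
  case/asboolP=> v [vS _ h]; rewrite leqNgt; apply/negP=> dT.
  have h1 := h ea; have h2 := h (ea + T); have := rankD ea vS; lia.
case: (ex_maxnP exQ ubQ) => d /asboolP[b [bS eb0 inb]] maxd.
have {}maxd d' v : Q d' v -> d' <= d by move=> h; apply: maxd; apply/asboolP; exists v.
have [||ob [eb [arcb /andP[obt teb]]]] := @arc_ex S K b ea bS eb0 T0 K2; [lia|by apply: inb; lia|].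
have ebE : eb = ea + d.+1.
  case: (arcb) => h1 _ rb inb' _; have := maxd (eb.-1 - ea) b; rewrite /Q => /(_ _)/wrap[].
    by split=> // u hu; apply: inb'; lia.
  case: (leqP eb (ea + d)) => h; first by have := inb eb; lia.
  lia.
have [c cS rc] := ex_first eb S0.
have ec0 : extreme S c by exists eb.
have [||oc [ec [arcc /andP[oct tec]]]] := @arc_ex S K c eb cS ec0 T0 K2; [lia|lia|].
have dT : d <= T by apply: ubQ; apply/asboolP; exists b.
case: (arca) => /andP[a1 a2] a3 a4 a5 a6; case: (arcb) => /andP[b1 b2] b3 b4 b5 b6.
case: (arcc) => /andP[c1 c2] c3 c4 c5 c6.
(* Otherwise the arc of c contains ea and reaches further than that of b. *)
have eaoc : ea <= oc.
  rewrite leqNgt; apply/negP=> h; have := maxd d.+1 c; rewrite /Q => /(_ _)/wrap[]; last by lia.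
  split=> // u hu; apply: c5; lia.
case: (pselect (forall t, rank S t a < K -> rank S t c < K -> False)) => [dis|].
  by left; exists a, c.
move=> /existsNP[t0 h0]; right; exists a, b, c, oa, ea, ob, eb, oc, ec.
have [t /andP[t1 t2] [ta tc]] : exists2 t, ea <= t < ea + 2 * T & rank S t a < K /\ rank S t c < K.
  apply: (periodic_shift (P := fun t => rank S t a < K /\ rank S t c < K) (f := t0)); first lia.
    by move=> t; rewrite !rank2T.
  by apply: contrapT => h; apply: h0 => h1 h2; apply: h.
have t3 : oa + 2 * T < t by have := a6 t; lia.
have t4 : t < ec by have := c6 t; lia.
by split=> //; split=> //; lia.
Qed.

(** * Swaps at low rank *)

Lemma rank_remove S t x a : a \in S -> rank S t x = bef t a x + rank (S :\ a) t x.
Proof.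
move=> aS; rewrite /rank (cardsD1 a) inE aS /=; congr (_ + _).
by apply: eq_card => z; rewrite !inE andbA.
Qed.

Definition low S K t x y : bool := flip t x y && (rank S t x < K).
(** The sum extends over a full period, in which a pair swaps twice, at ranks
    r and #|S| - 2 - r; for 2 * K < #|S| at most one of them is below K. *)
Definition low_flips S K := \sum_(0 <= t < 2 * T) \sum_(x in S) \sum_(y in S) low S K t x y.
Definition low_at S K (U : {set V}) a :=
  \sum_(0 <= t < 2 * T) \sum_(y in U) (low S K t a y + low S K t y a).

Lemma low2T S K t x y : low S K (t + 2 * T) x y = low S K t x y.
Proof. by rewrite /low flip2T rank2T. Qed.

Lemma sum_remove (F : V -> V -> nat) S a : a \in S -> F a a = 0 ->
  \sum_(x in S) \sum_(y in S) F x y =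
  \sum_(x in S :\ a) \sum_(y in S :\ a) F x y + \sum_(y in S :\ a) (F a y + F y a).
Proof.
move=> aS Fa; rewrite (big_setD1 a) //= (big_setD1 a) //= Fa add0n addnC big_split /=.
rewrite [X in X + _](_ : _ = \sum_(x in S :\ a) F x a + \sum_(x in S :\ a) \sum_(y in S :\ a) F x y).
  by rewrite [X in _ = _ + X]addnC addnA [X in X + _]addnC.
by rewrite -big_split; apply: eq_bigr => x _; rewrite (big_setD1 a).
Qed.

Lemma low_flips_remove S S' K a : a \in S' ->
  \sum_(0 <= t < 2 * T) \sum_(x in S') \sum_(y in S') low S K t x y =
  \sum_(0 <= t < 2 * T) \sum_(x in S' :\ a) \sum_(y in S' :\ a) low S K t x y
  + low_at S K (S' :\ a) a.
Proof.
move=> aS; rewrite -big_split; apply: eq_bigr => t _.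
by rewrite (sum_remove aS) // /low flipxx.
Qed.

Lemma sum_ge_levels (f : nat -> nat -> nat) (g : nat -> nat) s t K :
  (forall r, r < K -> exists2 u, s <= u < t & 0 < f u r) ->
  (forall u, s <= u < t -> \sum_(r < K) f u r <= g u) -> K <= \sum_(s <= u < t) g u.
Proof.
move=> h1 h2; rewrite big_nat; apply: (@leq_trans (\sum_(s <= u < t | s <= u < t) \sum_(r < K) f u r)).
  rewrite exchange_big /= -[X in X <= _]card_ord -sum1_card; apply: leq_sum => r _.
  have [u hu fu] := h1 r (ltn_ord r); rewrite -big_nat; exact: sum_ge1 hu fu.
exact: leq_sum.
Qed.

Lemma sum_ord_eq1 (b : bool) r K : \sum_(i < K) (b && (r == i)) = b && (r < K).
Proof.
case: b => /=; last by rewrite big1.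
case: (ltnP r K) => h.
  rewrite (bigD1 (Ordinal h)) //= eqxx big1 // => i ni; apply/eqP; rewrite eqb0.
  by apply: contra ni => /eqP e; apply/eqP/val_inj.
by rewrite big1 // => i _; apply/eqP; rewrite eqb0; have := ltn_ord i; lia.
Qed.

(** On its way from the first position to the last, a crosses each of the K
    lowest levels, and it crosses them again on its way back. *)
Lemma low_at_extreme S K a : a \in S -> extreme S a -> 2 * K < #|S| ->
  2 * K <= low_at S K (S :\ a) a.
Proof.
move=> aS [f rf] K2; rewrite /low_at -(@sum_period _ _ f); last first.
  by move=> t; apply: eq_bigr => y _; rewrite !low2T.
have rfT : rank S (f + T) a = #|S|.-1 by have := rankD f aS; lia.
have rf2 : rank S (f + 2 * T) a = 0 by rewrite rank2T.
rewrite (@big_cat_nat _ _ _ (f + T)) /=; [|lia|lia].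
rewrite mul2n -addnn; apply: leq_add.
  apply: (@sum_ge_levels (fun u r => \sum_(y in S :\ a) (flip u a y && (rank S u a == r)))).
    move=> r rK; have [|||u hu [y yS [fy ry]]] := @rank_up S f (f + T) a r aS; [lia|lia|lia|].
    exists u => //; rewrite (bigD1 y) /= ?fy ?ry ?eqxx // !inE yS andbT.
    by rewrite eq_sym; exact: flip_neq fy.
  move=> u _; rewrite exchange_big /=; apply: leq_sum => y _.
  by rewrite sum_ord_eq1 leq_addr.
apply: (@sum_ge_levels (fun u r => \sum_(y in S :\ a) (flip u y a && (rank S u y == r)))).
  move=> r rK; have [|||u hu [y yS [fy ry]]] := @rank_down S (f + T) (f + 2 * T) a r aS; [lia|lia|lia|].
  exists u; first lia.
  by rewrite (bigD1 y) /= ?fy ?ry ?eqxx // !inE yS andbT; exact: flip_neq fy.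
move=> u _; rewrite exchange_big /=; apply: leq_sum => y _.
by rewrite sum_ord_eq1 leq_addl.
Qed.

Lemma low_pair_once S K x y : x \in S -> y \in S -> 2 * K < #|S| ->
  \sum_(0 <= t < 2 * T) (low S K t x y + low S K t y x) <= 1.
Proof.
move=> xS yS K2; have T0 : x != y -> 0 < T.
  by move=> n; apply: (@T_gt0 S); apply/card_gt1P; exists x, y.
have e t : low S K t x y + low S K t y x = (low S K t x y || low S K t y x) :> nat.
  rewrite /low; case f: (flip t x y) => //=; case g: (flip t y x) => //=; last by case: (_ < _).
  by have [e _] := flip_single f g; rewrite e flipxx in f.
under eq_bigr do rewrite e.
apply: sum_bool_le1 => u u' _ uu' u2 h h'.
have sf t : low S K t x y || low S K t y x -> sflip t x y.
  by rewrite /low /sflip => /orP[]/andP[-> _] //; rewrite orbT.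
have uT := sflip_gap (sf _ h) (sf _ h') uu'.
have uE : u' = u + T.
  apply/eqP; rewrite eqn_leq uT andbT leqNgt; apply/negP=> lt.
  have := @sflip_gap (u + T) u' x y; rewrite sflipT => /(_ (sf _ h) (sf _ h') lt); lia.
have nxy : x != y by case/orP: h => /andP[/flip_neq]; rewrite // eq_sym.
rewrite {}uE /low !flipT in h'.
have := rankD u xS; have := rankD u yS.
move: h; rewrite /low; case f: (flip u x y); case g: (flip u y x) => //=.
- by have [e1 _] := flip_single f g; rewrite e1 eqxx in nxy.
- by move: h'; rewrite f g /=; have [] := rank_flip xS yS f; lia.
- by move: h'; rewrite f g /=; have [] := rank_flip yS xS g; lia.
Qed.

Lemma low_at_remove S K (U : {set V}) a x : a \in S -> x \in S -> x \in U -> 2 * K < #|S| ->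
  low_at S K U a <= low_at S K (U :\ x) a + 1.
Proof.
move=> aS xS xU K2; rewrite -leq_subLR; apply: leq_trans (low_pair_once aS xS K2).
rewrite leq_subLR -big_split; apply: eq_leq; apply: eq_bigr => t _.
by rewrite (big_setD1 x) //= addnC.
Qed.

(** At least 2 * K low swaps involve a, as many involve c, and at most one
    involves both. A swap of two other elements whose rank is below K - 1
    without a and c has rank at most K, and it can have rank K only when a and
    c are both in front of it; then both would be among the first K. *)
Lemma low_flips_two S K a c : a \in S -> c \in S -> extreme S a -> extreme S c ->
  0 < K -> 2 * K < #|S| ->
  (forall t, rank S t a < K -> rank S t c < K -> False) ->
  4 * K + low_flips (S :\ a :\ c) K.-1 <= low_flips S K + 1.
Proof.
move=> aS cS ea ec K0 K2 dis.
have nac : a != c.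
  by apply/eqP => e; case: ea => t r; apply: (dis t); rewrite -?e r.
have cSa : c \in S :\ a by rewrite !inE eq_sym nac.
have aSc : a \in S :\ c by rewrite !inE nac.
rewrite {2}/low_flips (low_flips_remove _ _ aS) (low_flips_remove _ _ cSa).
have h1 := low_at_extreme aS ea K2; have h2 := low_at_extreme cS ec K2.
have := low_at_remove cS aS aSc K2; rewrite [S :\ c :\ a]setDDl setUC -setDDl.
suff : low_flips (S :\ a :\ c) K.-1 <=
    \sum_(0 <= t < 2 * T) \sum_(x in S :\ a :\ c) \sum_(y in S :\ a :\ c) low S K t x y by lia.
rewrite /low_flips; apply: leq_sum => t _; apply: leq_sum => x xS; apply: leq_sum => y _.
rewrite /low; case: (flip t x y) => //=; case: ltnP => //= h; rewrite lt0b.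
rewrite (rank_remove _ _ aS) (rank_remove _ _ cSa).
set r := rank _ t x in h *; rewrite ltnNge; apply/negP=> Kr.
have [ax cx e] : [/\ bef t a x, bef t c x & r.+1 = K.-1].
  move: h Kr K0; clear.
  by case: (bef t a x); case: (bef t c x) => /= h1 h2 h3; split=> //; lia.
have rK : rank S t x < K.+1.
  by rewrite (rank_remove _ _ aS) (rank_remove _ _ cSa) ax cx -/r; move: e K0; clear; lia.
by apply: (dis t); [apply: leq_trans (bef_rank aS ax) rK|apply: leq_trans (bef_rank cS cx) rK].
Qed.

Definition prefix_set S K t := [set x in S | rank S t x < K].

Lemma prefix_arc S K t v : v \in S -> rank S t v = K -> prefix_set S K t = [set x in S | bef t x v].
Proof.
move=> vS rv; apply/setP=> x; rewrite !inE; case xS: (x \in S) => //=; rewrite -rv.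
by apply/idP/idP => [/(rank_bef vS)|/(bef_rank xS)].
Qed.

(** If no element outside S' crosses the boundary between ranks K - 1 and K,
    then each element that is new among the first K was brought in by a swap
    of two elements of S'. *)
Lemma prefix_flips S S' K s s' :
  (forall d t, d \in S -> d \notin S' -> s <= t < s' -> (rank S t d < K) = (rank S t.+1 d < K)) ->
  s <= s' -> #|prefix_set S K s' :\: prefix_set S K s| <=
    \sum_(s <= t < s') \sum_(x in S') \sum_(y in S') (flip t x y && ((rank S t x).+1 == K)).
Proof.
elim: s' => [|s' IH] st; first by rewrite leqn0 => /eqP ->; rewrite setDv cards0.
case: (ltngtP s s'.+1) => // [ss' _|-> _]; last by rewrite setDv cards0.
rewrite big_nat_recr //=.
have sub : prefix_set S K s'.+1 :\: prefix_set S K s \subset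
    (prefix_set S K s' :\: prefix_set S K s) :|: (prefix_set S K s'.+1 :\: prefix_set S K s').
  by apply/subsetP=> z; rewrite !inE; case: (_ \in S); case: (_ < K); case: (_ < K); case: (_ < K).
apply: leq_trans (subset_leq_card sub) _; apply: leq_trans (leq_card_setU _ _) _.
apply: leq_add; first by apply: IH => // d t dS dS' h; apply: st => //; lia.
have new z : z \in prefix_set S K s'.+1 :\: prefix_set S K s' -> exists x,
    [/\ x \in S', z \in S', flip s' x z & (rank S s' x).+1 = K].
  rewrite !inE => /andP[h1 /andP[zS h2]]; rewrite zS /= -leqNgt in h1.
  have [||x xS [f r1 r2]] := @rank_step_down S s' z K.-1 zS; [lia|lia|].
  have [r3 r4 r5] := rank_flip xS zS f.
  exists x; split=> //; try lia.
    by apply: contraT => xS'; have := st x s' xS xS'; lia.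
  by apply: contraT => zS'; have := st z s' zS zS'; lia.
have [->|[z zn]] := set_0Vmem (prefix_set S K s'.+1 :\: prefix_set S K s'); first by rewrite cards0.
have [x [xS' zS' f r]] := new z zn.
apply: (@leq_trans 1).
  rewrite -(cards1 z); apply: subset_leq_card; apply/subsetP=> z' /new[x' [_ _ f' _]].
  by rewrite inE; have [_ ->] := flip_single f f'.
by rewrite (bigD1 x) //= (bigD1 z) //= f r eqxx.
Qed.

(** Since A' misses D, the overlap of A and D lies in A minus A', which has as
    many elements as A' minus A. So the three overlaps of A, B, D are paid for
    by the three differences, and the union of A, B, D fits into S. *)
Lemma card_three_prefixes S (A A' B B' D D' : {set V}) K :
  [/\ #|A| = K, #|A'| = K, #|B| = K, #|B'| = K & #|D| = K] -> #|D'| = K ->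
  A \subset S -> B \subset S -> D \subset S ->
  A' :&: D = set0 -> B' :&: A = set0 -> D' :&: B = set0 ->
  3 * K <= #|S| + #|A' :\: A| + #|B' :\: B| + #|D' :\: D|.
Proof.
move=> [cA cA' cB cB' cD] cD' sA sB sD e1 e2 e3.
have swap (X Y Z : {set V}) : #|X| = #|Y| -> Y :&: Z = set0 -> #|X :&: Z| <= #|Y :\: X|.
  move=> cXY YZ; have <- : #|X :\: Y| = #|Y :\: X|.
    by have := cardsID Y X; have := cardsID X Y; rewrite (setIC Y); lia.
  apply: subset_leq_card; apply/subsetP=> z; rewrite !inE => /andP[-> zZ]; rewrite andbT.
  apply/negP=> zY; have : z \in Y :&: Z by rewrite inE zY zZ.
  by rewrite YZ inE.
have h1 := swap A A' D (etrans cA (esym cA')) e1.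
have h2 := swap B B' A (etrans cB (esym cB')) e2.
have h3 := swap D D' B (etrans cD (esym cD')) e3.
have h4 : #|A :|: B :|: D| <= #|S| by apply: subset_leq_card; rewrite !subUset sA sB sD.
have := cardsUI (A :|: B) D; have := cardsUI A B; rewrite setIUl.
have h5 : #|(A :&: D) :|: (B :&: D)| <= #|A :&: D| + #|B :&: D| := leq_card_setU _ _.
move: h5; rewrite (setIC A B) (setIC B D); lia.
Qed.

Lemma prefix_sub S K t : prefix_set S K t \subset S.
Proof. by apply/subsetP=> x; rewrite inE => /andP[]. Qed.

Lemma card_prefix S K t v : v \in S -> rank S t v = K -> #|prefix_set S K t| = K.
Proof. by move=> vS rv; rewrite (prefix_arc vS rv). Qed.

Lemma prefix_disjoint S K v o e : 0 < T -> 0 < K -> v \in S -> extreme S v -> arc S K v o e ->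
  prefix_set S K o :&: prefix_set S K e = set0.
Proof.
move=> T0 K0 vS ev a; case: (a) => _ ro re _ _; rewrite !(@prefix_arc _ _ _ v) //.
apply/setP=> y; rewrite !inE; apply/negP=> /andP[/andP[yS h1] /andP[_ h2]].
exact: (arc_disjoint T0 K0 ev a yS h1 h2).
Qed.

Lemma prefix2T S K t : prefix_set S K (t + 2 * T) = prefix_set S K t.
Proof. by apply/setP=> x; rewrite !inE rank2T. Qed.

Lemma low_flips_remove3 S K a b c : 2 * K < #|S| -> [/\ a \in S, b \in S & c \in S] ->
  [/\ extreme S a, extreme S b & extreme S c] -> [/\ a != b, b != c & a != c] ->
  6 * K + \sum_(0 <= t < 2 * T) \sum_(x in S :\ a :\ b :\ c) \sum_(y in S :\ a :\ b :\ c) low S K t x y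
    <= low_flips S K + 3.
Proof.
move=> K2 [aS bS cS] [xa xb xc] [nab nbc nac].
have bSa : b \in S :\ a by rewrite !inE eq_sym nab.
have cSab : c \in S :\ a :\ b by rewrite !inE ![c == _]eq_sym nac nbc.
have h1 := low_at_extreme aS xa K2.
have h2 := leq_trans (low_at_extreme bS xb K2) (low_at_remove bS aS (_ : a \in S :\ b) K2).
have {}h2 := h2 _; rewrite !inE nab in h2; have {}h2 := h2 aS.
have h3 := leq_trans (low_at_extreme cS xc K2) (low_at_remove cS aS (_ : a \in S :\ c) K2).
have {}h3 := h3 _; rewrite !inE nac in h3; have {}h3 := h3 aS.
have h4 := low_at_remove cS bS (_ : b \in S :\ c :\ a) K2.
have {}h4 := h4 _; rewrite !inE nbc eq_sym nab in h4; have {}h4 := h4 bS.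
rewrite [S :\ b :\ a]setDDl setUC -setDDl in h2.
rewrite [S :\ c :\ a]setDDl setUC -setDDl in h3 h4.
rewrite [S :\ a :\ c :\ b]setDDl setUC -setDDl in h4.
rewrite [low_flips _ _](low_flips_remove _ _ aS) (low_flips_remove _ _ bSa) (low_flips_remove _ _ cSab).
set S' := S :\ a :\ b :\ c in h1 h2 h3 h4 *; lia.
Qed.

(** Removing three elements lowers a rank by at most three. So a swap of rank
    below K - 2 has rank at most K, and rank K only if a, b, c are all among
    the first K. While exactly one of them is among the first K, the swaps of
    rank K - 1 are also low; they have rank K - 2 after the removal, so they
    are counted in addition. *)
Lemma low_remove3 S K a b c t x y (g : bool) : [/\ a \in S, b \in S & c \in S] ->
  [/\ a != b, b != c & a != c] -> x \in S :\ a :\ b :\ c ->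
  (rank S t a < K -> rank S t b < K -> rank S t c < K -> False) ->
  (g -> (rank S t a < K) + (rank S t b < K) + (rank S t c < K) = 1) ->
  low (S :\ a :\ b :\ c) (K - 2) t x y + g * (flip t x y && ((rank S t x).+1 == K)) <= low S K t x y.
Proof.
move=> [aS bS cS] [nab nbc nac] xS triple one.
have bSa : b \in S :\ a by rewrite !inE eq_sym nab.
have cSab : c \in S :\ a :\ b by rewrite !inE ![c == _]eq_sym nac nbc.
rewrite /low; case: (flip t x y) => /=; last by rewrite muln0.
have xS0 : x \in S by move: xS; rewrite !inE => /and4P[].
have E : rank S t x = bef t a x + (bef t b x + (bef t c x + rank (S :\ a :\ b :\ c) t x)).
  by rewrite (rank_remove _ _ aS) (rank_remove _ _ bSa) (rank_remove _ _ cSab).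
have bK v : v \in S -> rank S t x < K.+1 -> bef t v x -> rank S t v < K.
  by move=> vS hx /(bef_rank vS) /leq_trans; apply.
have eb v : v \in S -> v != x -> (rank S t x).+1 = K -> bef t v x = (rank S t v < K).
  move=> vS nvx rK; apply/idP/idP => h; first by apply: bK => //; rewrite -rK.
  apply: (rank_bef xS0); rewrite ltn_neqAle -ltnS rK h andbT.
  by apply: contra nvx => /eqP /(rank_inj vS xS0) /eqP.
have [xa xb xc] : [/\ a != x, b != x & c != x].
  by move: xS; rewrite !inE ![x == _]eq_sym => /and4P[-> -> ->].
move: E; set r' := rank (_ :\ c) t x => E.
case gr: (g && ((rank S t x).+1 == K)).
  case/andP: gr => gg /eqP r; have := one gg.
  rewrite -(eb a) // -(eb b) // -(eb c) // -r gg eqxx => h.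
  by rewrite E !addnA h; clear; lia.
rewrite (_ : g * _ = 0) ?addn0; last by move: gr; case: g one => //= _ ->.
case: ltnP => //= r; rewrite lt0b ltnNge; apply/negP=> r'K.
have [ax bx cx rK] : [/\ bef t a x, bef t b x, bef t c x & rank S t x < K.+1].
  move: r r'K; rewrite E; clear.
  by case: (bef t a x); case: (bef t b x); case: (bef t c x) => /= h1 h2; split=> //; lia.
by apply: triple; apply: bK.
Qed.

(** Only b is among the first K during [ea, oc], only c during [eb, oa + 2 *
    T], and only a during [ec, ob + 2 * T]. In each of these gaps the first K
    elements change from one set to another. The set at the end of a gap and
    the set at the beginning of the next gap but one belong to the two ends of
    one arc, so they are disjoint. By card_three_prefixes, the gaps contain at
    least 3 * K - #|S| swaps of rank K - 1, in addition to the swaps that are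
    low after the removal. *)
Lemma low_flips_three S K a b c oa ea ob eb oc ec : 0 < T -> 0 < K -> 2 * K < #|S| ->
  [/\ a \in S, b \in S & c \in S] -> [/\ extreme S a, extreme S b & extreme S c] ->
  [/\ arc S K a oa ea, arc S K b ob eb & arc S K c oc ec] ->
  [/\ ob < ea, ea <= oc & oc < eb] ->
  [/\ eb <= oa + 2 * T, oa + 2 * T < ec & ec <= ob + 2 * T] ->
  [/\ a != b, b != c & a != c] /\
  6 * K + low_flips (S :\ a :\ b :\ c) (K - 2) + (3 * K - #|S|) <= low_flips S K + 3.
Proof.
move=> T0 K0 K2 [aS bS cS] [xa xb xc] [arca arcb arcc] [q1 q2 q3] [q4 q5 q6].
case: (arca) => /andP[a1 a2] a3 a4 a5 a6; case: (arcb) => /andP[b1 b2] b3 b4 b5 b6.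
case: (arcc) => /andP[c1 c2] c3 c4 c5 c6.
have a5' t : oa + 2 * T < t < ea + 2 * T -> rank S t a < K.
  by move=> h; rewrite (_ : t = t - 2 * T + 2 * T) ?rank2T ?a5 //; lia.
have c6' t : ec <= t + 2 * T <= oc + 2 * T -> K <= rank S t c by move=> h; rewrite -rank2T c6.
have gap1 t : ea <= t <= oc -> [/\ K <= rank S t a, rank S t b < K & K <= rank S t c].
  by move=> h; split; [apply: a6|apply: b5|apply: c6']; lia.
have gap2 t : eb <= t <= oa + 2 * T -> [/\ K <= rank S t a, K <= rank S t b & rank S t c < K].
  by move=> h; split; [apply: a6|apply: b6|apply: c5]; lia.
have gap3 t : ec <= t <= ob + 2 * T -> [/\ rank S t a < K, K <= rank S t b & K <= rank S t c].
  by move=> h; split; [apply: a5'|apply: b6|apply: c6]; lia.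
have triple t : rank S t a < K -> rank S t b < K -> rank S t c < K -> False.
  move=> h1 h2 h3.
  have [u /andP[u1 u2] [ua ub uc]] : exists2 u, ea <= u < ea + 2 * T
      & [/\ rank S u a < K, rank S u b < K & rank S u c < K].
    by apply: (@periodic_shift _ _ t); [lia|move=> u; rewrite !rank2T|].
  have := a6 u; have := b6 u; have := c6 u; lia.
have nab : a != b by apply/eqP => e; have [] := gap1 ea; rewrite ?e; lia.
have nbc : b != c by apply/eqP => e; have [] := gap1 ea; rewrite ?e; lia.
have nac : a != c by apply/eqP => e; have [] := gap2 eb; rewrite ?e; lia.
split; first by split.
have := low_flips_remove3 K2 (And3 aS bS cS) (And3 xa xb xc) (And3 nab nbc nac).
set S' := S :\ a :\ b :\ c.
pose gap t := [|| ea <= t < oc, eb <= t < oa + 2 * T | ec <= t < ob + 2 * T].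
pose bd t := \sum_(x in S') \sum_(y in S') (flip t x y && ((rank S t x).+1 == K)).
suff [k1 k2] : low_flips S' (K - 2) + \sum_(ea <= t < ea + 2 * T) (gap t) * bd t <=
    \sum_(0 <= t < 2 * T) \sum_(x in S') \sum_(y in S') low S K t x y
  /\ 3 * K <= #|S| + \sum_(ea <= t < ea + 2 * T) (gap t) * bd t by lia.
split.
  have per F : (forall t, F (t + 2 * T) = F t) ->
      \sum_(0 <= t < 2 * T) F t = \sum_(ea <= t < ea + 2 * T) F t.
    by move=> h; rewrite (@sum_period F).
  rewrite /low_flips !per; last 2 first.
  - by move=> t; apply: eq_bigr => x _; apply: eq_bigr => y _; rewrite low2T.
  - by move=> t; apply: eq_bigr => x _; apply: eq_bigr => y _; rewrite low2T.
  rewrite -big_split; apply: leq_sum => t _ /=; rewrite /bd big_distrr -big_split.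
  apply: leq_sum => x xS /=; rewrite big_distrr -big_split; apply: leq_sum => y yS /=.
  apply: low_remove3 => //; first exact: triple.
  move=> g; have [g1|[g2|g3]] : ea <= t <= oc \/ eb <= t <= oa + 2 * T \/ ec <= t <= ob + 2 * T.
  - by clear -g; move: g; rewrite /gap; lia.
  - by have [u1 u2 u3] := gap1 t g1; rewrite u2 !ltnNge u1 u3.
  - by have [u1 u2 u3] := gap2 t g2; rewrite u3 !ltnNge u1 u2.
  - by have [u1 u2 u3] := gap3 t g3; rewrite u1 !ltnNge u2 u3.
have split3 : \sum_(ea <= t < oc) bd t + \sum_(eb <= t < oa + 2 * T) bd t
    + \sum_(ec <= t < ob + 2 * T) bd t <= \sum_(ea <= t < ea + 2 * T) gap t * bd t.
  have part s t : (forall u, s <= u < t -> gap u) ->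
      \sum_(s <= u < t) bd u = \sum_(s <= u < t) gap u * bd u.
    by move=> h; rewrite !big_nat; apply: eq_bigr => u hu; rewrite h // mul1n.
  rewrite !part; try by move=> u; rewrite /gap => ->; rewrite ?orbT.
  rewrite [X in _ <= X](@big_cat_nat _ _ _ oc) /=; [|lia|lia].
  rewrite [X in _ <= _ + X](@big_cat_nat _ _ _ eb) /=; [|lia|lia].
  rewrite [X in _ <= _ + (_ + X)](@big_cat_nat _ _ _ (oa + 2 * T)) /=; [|lia|lia].
  rewrite [X in _ <= _ + (_ + (_ + X))](@big_cat_nat _ _ _ ec) /=; [|lia|lia].
  rewrite [X in _ <= _ + (_ + (_ + (_ + X)))](@big_cat_nat _ _ _ (ob + 2 * T)) /=; [|lia|lia].
  lia.
have inS' d : d \in S -> d \notin S' -> [\/ d = a, d = b | d = c].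
  rewrite !inE => -> /=; rewrite andbT !negb_and !negbK => /or3P[]/eqP ->;
  by [constructor 1|constructor 2|constructor 3].
have p1 : #|prefix_set S K oc :\: prefix_set S K ea| <= \sum_(ea <= t < oc) bd t.
  apply: prefix_flips; last by [].
  move=> d t dS dS' h.
  have i1 : ea <= t <= oc by lia.
  have i2 : ea <= t.+1 <= oc by lia.
  move: (gap1 t i1) (gap1 t.+1 i2); clear -inS' dS dS' => -[u1 u2 u3] [v1 v2 v3].
  by case: (inS' d dS dS') => ->; lia.
have p2 : #|prefix_set S K (oa + 2 * T) :\: prefix_set S K eb| <= \sum_(eb <= t < oa + 2 * T) bd t.
  apply: prefix_flips; last by [].
  move=> d t dS dS' h.
  have i1 : eb <= t <= oa + 2 * T by lia.
  have i2 : eb <= t.+1 <= oa + 2 * T by lia.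
  move: (gap2 t i1) (gap2 t.+1 i2); clear -inS' dS dS' => -[u1 u2 u3] [v1 v2 v3].
  by case: (inS' d dS dS') => ->; lia.
have p3 : #|prefix_set S K (ob + 2 * T) :\: prefix_set S K ec| <= \sum_(ec <= t < ob + 2 * T) bd t.
  apply: prefix_flips; last by [].
  move=> d t dS dS' h.
  have i1 : ec <= t <= ob + 2 * T by lia.
  have i2 : ec <= t.+1 <= ob + 2 * T by lia.
  move: (gap3 t i1) (gap3 t.+1 i2); clear -inS' dS dS' => -[u1 u2 u3] [v1 v2 v3].
  by case: (inS' d dS dS') => ->; lia.
have := @card_three_prefixes S (prefix_set S K ea) (prefix_set S K oc) (prefix_set S K eb)
  (prefix_set S K (oa + 2 * T)) (prefix_set S K ec) (prefix_set S K (ob + 2 * T)) K.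
rewrite !prefix2T in p2 p3 *.
rewrite (card_prefix aS a4) (card_prefix cS c3) (card_prefix bS b4) (card_prefix aS a3)
  (card_prefix cS c4) (card_prefix bS b3) !prefix_sub.
rewrite (prefix_disjoint T0 K0 cS xc arcc) (prefix_disjoint T0 K0 aS xa arca)
  (prefix_disjoint T0 K0 bS xb arcb).
have triv : [/\ K = K, K = K, K = K, K = K & K = K] by [].
move=> /(_ triv erefl isT isT isT erefl erefl erefl); lia.
Qed.

(** The subtraction is truncated: the terms are the positive parts of 3 j - n. *)
Definition excess n K := \sum_(1 <= j < K.+1) (3 * j - n).

Lemma excess2 n K : 0 < K -> 2 * K < n -> excess n K <= excess (n - 2) K.-1 + K.-1.
Proof.
case: K => // K _ Kn; rewrite /excess big_ltn // big_add1 /= (_ : 3 * 1 - n = 0) ?add0n; last by lia.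
have -> : \sum_(1 <= j < K.+1) (3 * j - (n - 2)) + K = \sum_(1 <= j < K.+1) (3 * j - (n - 2) + 1).
  by rewrite big_split /= sum_nat_const_nat muln1 subn1.
apply: leq_sum => j _; lia.
Qed.

Lemma excess3 n K : 1 < K -> 2 * K < n -> excess n K = excess (n - 3) (K - 2) + (3 * K - n).
Proof.
case: K => [|[|K]] // _ Kn; rewrite /excess big_nat_recr //= big_ltn // big_add1 /=.
rewrite (_ : 3 * 1 - n = 0) ?add0n ?subn2 //=; last by lia.
by congr (_ + _); apply: eq_bigr => j _; lia.
Qed.

(** Induction on the number of elements. Two disjoint arcs lead from K to K -
    1 with two elements less, three arcs that cover the circle lead to K - 2
    with three elements less. *)
Lemma low_flips_lb S K : 2 * K < #|S| ->
  3 * 'C(K.+1, 2) + excess #|S| K <= low_flips S K.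
Proof.
have [n] := ubnP #|S|; elim: n S K => // n IH S K /ltnSE Sn K2.
case: (posnP K) => [->|K0]; first by rewrite /excess big_geq.
have T0 : 0 < T by apply: (@T_gt0 S); lia.
case: (arc_select T0 K0 K2) => [[a [c [aS cS ea ec dis]]]|].
  have h := low_flips_two aS cS ea ec K0 K2 dis.
  have nac : c != a.
    by apply/eqP => e; case: ea => t r; apply: (dis t); rewrite ?e r.
  have cSa : c \in S :\ a by rewrite !inE nac.
  have card2 : #|S :\ a :\ c| = #|S| - 2.
    by have := cardsD1 a S; have := cardsD1 c (S :\ a); rewrite aS cSa; lia.
  have := IH (S :\ a :\ c) K.-1; rewrite card2 => /(_ _ _)/wrap[]; [lia|lia|].
  move: h (excess2 K0 K2); rewrite prednK // binS bin1; clear -K0; lia.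
case=> a [b [c [oa [ea [ob [eb [oc [ec [m1 m2 m3 m4 m5]]]]]]]]].
have [[nab nbc nac] h] := low_flips_three T0 K0 K2 m1 m2 m3 m4 m5.
case: (leqP K 1) => K1.
  have KE : K = 1 by lia.
  move: h; rewrite KE /excess big_nat1 binn; move: K2; rewrite KE; clear; lia.
have card3 : #|S :\ a :\ b :\ c| = #|S| - 3.
  case: m1 => aS bS cS.
  have := cardsD1 a S; have := cardsD1 b (S :\ a); have := cardsD1 c (S :\ a :\ b).
  rewrite !inE aS bS cS ![b == a]eq_sym ![c == _]eq_sym nab nbc nac; clear; lia.
have := IH (S :\ a :\ b :\ c) (K - 2); rewrite card3 => /(_ _ _)/wrap[]; [lia|lia|].
move: h; rewrite (excess3 K1 K2); case: K K1 {K0 K2 m3 IH card3} => [|[|K]] // _.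
by rewrite subn2 /= !binS !bin1 !bin0; clear; lia.
Qed.

(** * Swaps in the central window *)

Local Notation rk := (rank [set: V]).

Definition window K t := [set x | K <= rk t x < #|V| - K].
(** These elements obstruct the charging of a swap in the window to the last
    entrance of one of its elements: a swap of two of them has no such
    entrance. *)
Definition always K := [set x | `[< forall t, x \in window K t >]].
Definition half_flips (Q : pred nat) :=
  \sum_(0 <= t < T) \sum_x \sum_y (flip t x y && Q (rk t x)).
Definition inner K r := (K <= r) && (r.+1 < #|V| - K).
Definition border K r := (r.+1 == K) || (r.+1 == #|V| - K).

Lemma rk_lt t x : rk t x < #|V|.
Proof. by rewrite -cardsT rank_lt // inE. Qed.

Lemma rkD t x : rk (t + T) x + rk t x = #|V|.-1.
Proof. by rewrite rankD ?cardsT // inE. Qed.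

Lemma windowT K t : window K (t + T) = window K t.
Proof.
by apply/setP=> x; rewrite !inE; have := rkD t x; have := rk_lt t x; have := rk_lt (t + T) x; lia.
Qed.

Lemma card_window K t : #|window K t| <= #|V| - 2 * K.
Proof.
rewrite cardE -(size_map (rk t)) -(size_iota K (#|V| - 2 * K)); apply: uniq_leq_size.
  rewrite map_inj_in_uniq ?enum_uniq // => x y _ _ /rank_inj; apply; exact: in_setT.
by move=> r /mapP[x]; rewrite mem_enum inE => h ->; rewrite mem_iota; lia.
Qed.

(** The window at time t + T consists of the same elements as at time t, so T
    consecutive times represent all of them. *)
Lemma always_intro K t x : 0 < T -> (forall u, t < u -> u <= t + T -> x \in window K u) -> x \in always K.
Proof.
move=> T0 h; rewrite inE; apply/asboolP=> s; apply/negPn/negP=> xs.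
have [|u hu] := @periodic_shift (fun u => x \notin window K u) T s t.+1 T0 _ xs.
  by move=> u; rewrite windowT.
by rewrite h //; lia.
Qed.

Lemma always_window K t x : x \in always K -> x \in window K t.
Proof. by rewrite inE => /asboolP. Qed.

(** The ordered pairs of elements that do leave the window at some time, but
    not before their next swap. Their number is the potential that replaces an
    explicit charging: it is periodic, a swap in the window lowers it, and
    only an entrance can raise it. *)
Definition pending K t := [set p : V * V | [&& p.1 != p.2, p.1 \notin always K, p.2 \notin always K
  & `[< exists s, [/\ t <= s, sflip s p.1 p.2
        & forall u, t <= u <= s -> p.1 \in window K u /\ p.2 \in window K u] >]]].

Lemma pendingT K t : pending K (t + T) = pending K t.
Proof.
apply/setP=> -[x y]; rewrite !inE /=; congr [&& _, _, _ & _]; apply/asboolP/asboolP => -[s [h1 h2 h3]].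
  exists (s - T); split; first lia.
    by rewrite -sflipT subnK //; lia.
  by move=> u hu; rewrite -!(windowT K u); apply: h3; lia.
exists (s + T); split; [lia|by rewrite sflipT|move=> u hu].
by rewrite (_ : u = u - T + T) ?windowT; [apply: h3|]; lia.
Qed.

Definition crossing K t := \sum_x \sum_y
  [&& x \notin always K, y \notin always K, flip t x y & inner K (rk t x)].
Definition borders K t := \sum_x \sum_y (flip t x y && border K (rk t x)).

Lemma window_enter K t z : 0 < K -> 2 * K < #|V| -> z \notin window K t -> z \in window K t.+1 ->
  exists x y, [/\ flip t x y, border K (rk t x)
    & (z = x /\ (rk t x).+1 = K) \/ (z = y /\ (rk t x).+1 = #|V| - K)].
Proof.
move=> K0 K2; rewrite !inE => h1 h2.
case: (rank_cases t (in_setT z)) => [e|[y _ f]|[y _ f]]; first by rewrite e in h2; lia.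
  have [r1 r2 r3] := rank_flip (in_setT z) (in_setT y) f.
  by exists z, y; split=> //; [rewrite /border|left; split=> //]; lia.
have [r1 r2 r3] := rank_flip (in_setT y) (in_setT z) f.
by exists y, z; split=> //; [rewrite /border|right; split=> //]; lia.
Qed.

Lemma sum2_ge1 (F : V -> V -> nat) x y : 0 < F x y -> 0 < \sum_x \sum_y F x y.
Proof. by move=> h; rewrite (bigD1 x) //= (bigD1 y) //=; lia. Qed.

(** A swap inside the window removes its pair in both orders: the pair swaps
    again only T steps later, and an element that stays in the window for T
    steps never leaves it. A pair that becomes pending contains the element
    that enters in this step, which happens by a border swap; the other
    element is one of the remaining elements of the window that do leave it. *)
Lemma pending_step K t : 0 < K -> 2 * K < #|V| -> 0 < T ->
  2 * crossing K t + #|pending K t.+1| <=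
  #|pending K t| + 2 * (#|V| - 2 * K - #|always K| - 1) * borders K t.
Proof.
move=> K0 K2 T0.
have back p : p \in pending K t.+1 -> p.1 \in window K t -> p.2 \in window K t -> p \in pending K t.
  rewrite !inE => /and4P[-> -> -> /asboolP[s [h1 h2 h3]]] w1 w2; apply/asboolP.
  exists s; split=> [|//|u hu]; first lia.
  case: (eqVneq u t) => [->|n]; first by rewrite !inE.
  by apply: h3; lia.
have inw p : p \in pending K t.+1 -> p.1 \in window K t.+1 /\ p.2 \in window K t.+1.
  by rewrite !inE => /and4P[_ _ _ /asboolP[s [h1 h2 h3]]]; have := h3 t.+1; rewrite !inE; apply; lia.
case: (pickP [pred p : V * V | [&& p.1 \notin always K, p.2 \notin always K, flip t p.1 p.2
    & inner K (rk t p.1)]]) => [[x y] /= /and4P[xA yA f i]|none].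
  have [r1 r2 r3] := rank_flip (in_setT x) (in_setT y) f.
  have nxy := flip_neq f.
  have c1 : crossing K t = 1.
    rewrite /crossing (bigD1 x) //= (bigD1 y) //= xA yA f i /= big1 ?big1 // => [x' nx|y' ny].
      rewrite big1 // => y' _; case f': (flip t x' y'); rewrite ?andbF //.
      by have [e _] := flip_single f f'; rewrite e eqxx in nx.
    case f': (flip t x y'); rewrite ?andbF //.
    by have [_ e] := flip_single f f'; rewrite e eqxx in ny.
  have wt z : z \in window K t.+1 -> z \in window K t.
    move=> zw; apply: contraT => zn; have [x' [y' [f' b _]]] := window_enter K0 K2 zn zw.
    have [e _] := flip_single f f'; rewrite -e /border in b.
    by move: i; rewrite /inner; lia.
  have inp : [/\ (x, y) \in pending K t, (y, x) \in pending K t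
     & (x, y) != (y, x)].
    have xw : x \in window K t by move: i; rewrite !inE /inner; lia.
    have yw : y \in window K t by move: i; rewrite !inE /inner; lia.
    have ut u : t <= u <= t -> u = t by lia.
    split; last by rewrite xpair_eqE negb_and nxy.
      rewrite inE /= nxy xA yA; apply/asboolP; exists t; split=> // [|u /ut ->] //.
      by rewrite /sflip f.
    rewrite inE /= eq_sym nxy xA yA; apply/asboolP; exists t; split=> // [|u /ut ->] //.
    by rewrite /sflip f orbT.
  case: inp => p1 p2 np.
  have nout p : (p == (x, y)) || (p == (y, x)) -> p \notin pending K t.+1.
    move=> hp; apply/negP; rewrite inE => /and4P[_ _ _ /asboolP[s [h1 h2 h3]]].
    have sf : sflip t p.1 p.2 by case/orP: hp => /eqP -> /=; rewrite /sflip f ?orbT.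
    have gap := sflip_gap sf h2 h1.
    have : p.1 \in always K.
      by apply: (always_intro T0 (t := t)) => u u1 u2; apply: (h3 u _).1; move: u1 u2 gap; clear; lia.
    by case/orP: hp => /eqP -> /=; rewrite ?(negPf xA) ?(negPf yA).
  have sub : pending K t.+1 \subset pending K t :\ (x, y) :\ (y, x).
    apply/subsetP=> p hp; have [w1 w2] := inw p hp.
    rewrite !in_setD1 back ?wt // andbT.
    by apply/andP; split; apply: contraTneq hp => e; apply: nout; rewrite e eqxx ?orbT.
  have := subset_leq_card sub; have := cardsD1 (x, y) (pending K t).
  have := cardsD1 (y, x) (pending K t :\ (x, y)); rewrite in_setD1 eq_sym np p1 p2 c1 /=.
  move=> e1 e2 e3; apply: leq_trans (leq_addr _ _); move: e1 e2 e3; clear; lia.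
have -> : crossing K t = 0.
  rewrite /crossing big1 // => x _; rewrite big1 // => y _; apply/eqP; rewrite eqb0.
  by have := none (x, y); rewrite /= => ->.
rewrite add0n; case: (pickP [pred z | (z \notin window K t) && (z \in window K t.+1)]) => [z|stay]; last first.
  have wt z : z \in window K t.+1 -> z \in window K t.
    by move=> zw; apply: contraT => zn; have := stay z; rewrite /= zn zw.
  apply: leq_trans (leq_addr _ _); apply: subset_leq_card; apply/subsetP=> p hp.
  by have [w1 w2] := inw p hp; apply: back => //; apply: wt.
case/andP=> zn zw; have [x [y [f b e]]] := window_enter K0 K2 zn zw.
have b1 : 0 < borders K t by apply: (sum2_ge1 (x := x) (y := y)); rewrite f b.
have [r1 r2 r3] := rank_flip (in_setT x) (in_setT y) f.
have uniq z' : z' \notin window K t -> z' \in window K t.+1 -> z' = z.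
  move=> zn' zw'; have [x' [y' [f' b' e']]] := window_enter K0 K2 zn' zw'.
  have [ex ey] := flip_single f f'; rewrite -ex -ey in e' b'.
  by case: e e' => -[-> k1] [] [-> k2] //; move: k1 k2 K2; clear; lia.
have zA : z \notin always K by apply: contra zn => /always_window.
pose Y := window K t.+1 :\: always K :\ z.
have cY : #|Y| <= #|V| - 2 * K - #|always K| - 1.
  have := cardsD1 z (window K t.+1 :\: always K); rewrite in_setD zA zw -/Y.
  have sA : always K \subset window K t.+1 by apply/subsetP=> v /always_window.
  have := cardsID (always K) (window K t.+1); rewrite (setIidPr sA).
  by have := card_window K t.+1; clear; lia.
have sub : pending K t.+1 \subset pending K t :|: ([set (z, v) | v in Y] :|: [set (v, z) | v in Y]).
  apply/subsetP=> p hp; have [w1 w2] := inw p hp; rewrite !in_setU.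
  have [n1 n2 n3] : [/\ p.1 != p.2, p.1 \notin always K & p.2 \notin always K].
    by move: hp; rewrite inE => /and4P[-> -> -> _].
  case h1: (p.1 \in window K t); last first.
    have e1 := uniq p.1 (negbT h1) w1; apply/orP; right; apply/orP; left.
    apply/imsetP; exists p.2; last by rewrite -e1; case: (p).
    by rewrite /Y in_setD1 in_setD n3 w2 -e1 eq_sym n1.
  case h2: (p.2 \in window K t); last first.
    have e1 := uniq p.2 (negbT h2) w2; apply/orP; right; apply/orP; right.
    apply/imsetP; exists p.1; last by rewrite -e1; case: (p).
    by rewrite /Y in_setD1 in_setD n2 w1 -e1 n1.
  by rewrite back.
apply: leq_trans (subset_leq_card sub) _; apply: leq_trans (leq_card_setU _ _) _.
rewrite leq_add2l; apply: leq_trans (leq_card_setU _ _) _.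
have c1 := leq_imset_card (fun v => (z, v)) Y; have c2 := leq_imset_card (fun v => (v, z)) Y.
apply: leq_trans (leq_pmulr _ b1); move: c1 c2 cY; clear; lia.
Qed.

Lemma crossing_total K : 0 < K -> 2 * K < #|V| -> 0 < T ->
  \sum_(0 <= t < T) crossing K t <= (#|V| - 2 * K - #|always K| - 1) * half_flips (border K).
Proof.
move=> K0 K2 T0.
have shift : \sum_(0 <= t < T) #|pending K t.+1| = \sum_(0 <= t < T) #|pending K t|.
  rewrite -(@sum_period (fun t => #|pending K t|) T 1); last by move=> t; rewrite pendingT.
  by rewrite add1n big_add1.
have : \sum_(0 <= t < T) (2 * crossing K t + #|pending K t.+1|) <=
   \sum_(0 <= t < T) (#|pending K t| + 2 * (#|V| - 2 * K - #|always K| - 1) * borders K t).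
  by apply: leq_sum => t _; apply: pending_step.
rewrite big_split [X in _ <= X]big_split /= shift addnC leq_add2l -!big_distrr /= -mulnA => h.
by rewrite -(leq_pmul2l (isT : 0 < 2)).
Qed.

Lemma flip_once x y : \sum_(0 <= t < T) (flip t x y + flip t y x) <= (x != y).
Proof.
case: (eqVneq x y) => [->|n]; first by rewrite big1 // => t _; rewrite flipxx.
have e t : flip t x y + flip t y x = sflip t x y :> nat.
  rewrite /sflip; case f: (flip t x y) => //=; case g: (flip t y x) => //.
  by have [e1 _] := flip_single f g; rewrite e1 eqxx in n.
under eq_bigr do rewrite e.
apply: sum_bool_le1 => u u' _ uu' u'T h h'; have := sflip_gap h h' uu'; lia.
Qed.

Lemma sum_pairs_meeting (A : {set V}) :
  \sum_x \sum_y (((x \in A) || (y \in A)) && (x != y)) = #|A| * (2 * #|V| - #|A| - 1).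
Proof.
have n1 x : \sum_y (x != y) = #|V|.-1.
  rewrite -(cardC1 x) -sum1_card [RHS]big_mkcond; apply: eq_bigr => y _.
  by rewrite inE eq_sym; case: eqP.
have n2 x : x \notin A -> \sum_y ((y \in A) && (x != y)) = #|A|.
  move=> xA; rewrite -sum1_card [RHS]big_mkcond; apply: eq_bigr => y _.
  by case: (eqVneq x y) => [<-|]; rewrite ?(negPf xA) //; case: (y \in A).
rewrite (bigID (mem A)) /= [X in X + _](_ : _ = #|A| * #|V|.-1); last first.
  by rewrite -sum_nat_const; apply: eq_bigr => x ->; rewrite /= n1.
rewrite [X in _ + X](_ : _ = #|~: A| * #|A|); last first.
  rewrite -sum_nat_const [RHS](eq_bigl (fun x => x \notin A)); last by move=> x; rewrite inE.
  by apply: eq_bigr => x xA; rewrite (negPf xA) /= n2.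
rewrite [_ * #|A|]mulnC -mulnDr -(cardsC A).
by move: #|A| #|~: A| => [|a] b //; congr (_ * _); lia.
Qed.

Lemma half_flips_inner K : 2 * half_flips (inner K) <=
  #|always K| * (2 * #|V| - #|always K| - 1) + 2 * \sum_(0 <= t < T) crossing K t.
Proof.
pose m x y := (x \in always K) || (y \in always K).
have h1 : half_flips (inner K) <= \sum_(0 <= t < T) \sum_x \sum_y (m x y && flip t x y)
    + \sum_(0 <= t < T) crossing K t.
  rewrite -big_split; apply: leq_sum => t _; rewrite -big_split; apply: leq_sum => x _.
  rewrite -big_split; apply: leq_sum => y _ /=; rewrite /m.
  by case: (x \in _); case: (y \in _); case: (flip _ _ _); case: (inner _ _).
have h2 : 2 * \sum_(0 <= t < T) \sum_x \sum_y (m x y && flip t x y) <=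
   #|always K| * (2 * #|V| - #|always K| - 1).
  rewrite -sum_pairs_meeting mul2n -addnn.
  rewrite {2}(eq_bigr (fun t => \sum_x \sum_y (m x y && flip t y x))); last first.
    move=> t _; rewrite exchange_big; apply: eq_bigr => x _; apply: eq_bigr => y _.
    by rewrite /m orbC.
  rewrite -big_split /=; under eq_bigr => t _ do rewrite -big_split /=.
  rewrite exchange_big; apply: leq_sum => x _ /=.
  under eq_bigr => t _ do rewrite -big_split /=.
  rewrite exchange_big; apply: leq_sum => y _ /=; rewrite -/(m x y).
  by case: (m x y) => /=; [apply: flip_once|rewrite big1].
by move: h1 h2; clear; lia.
Qed.

(** Let w be the size of the window, a the number of elements that never leave
    it and B the number of border swaps. At most a (2 n - a - 1) / 2 pairs
    contain one of these elements; the other pairs swap at most (w - a - 1) B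
    times in the window. If 2 B is at least 2 n - a - 1, then the first bound
    is at most a B, and the sum is at most (w - 1) B. Otherwise, B is so small
    that the sum is at most (w - 1) n. *)
Lemma window_flips K : 0 < K -> 2 * K < #|V| ->
  half_flips (inner K) <= (#|V| - 2 * K - 1) * half_flips (border K) \/
  half_flips (inner K) <= #|V| * (#|V| - 2 * K - 1).
Proof.
move=> K0 K2; have T0 : 0 < T by apply: (@T_gt0 [set: V]); rewrite cardsT; lia.
(* The first element at time 0 is the last one at time T; on its way it
   passes through the window, so it is there without staying. *)
have aw : #|always K| < #|V| - 2 * K.
  have [|x _ rx] := @ex_first [set: V] 0; first by rewrite cardsT; lia.
  have [|||u _ [y _ [f ru]]] := @rank_up [set: V] 0 T x K (in_setT x) => //; first by rewrite rx.
    by have := rkD 0 x; rewrite rx add0n; lia.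
  apply: leq_trans (card_window K u); apply: proper_card; apply/properP; split.
    by apply/subsetP=> v /always_window.
  exists x; first by rewrite inE ru; lia.
  apply/negP=> /(always_window 0); rewrite inE rx; lia.
have h1 := half_flips_inner K; have h2 := crossing_total K0 K2 T0.
set a := #|always K| in aw h1 h2; set n := #|V| in K2 aw h1 h2 *.
set B := half_flips (border K) in h2 *; set w := n - 2 * K in aw h2 *.
have wn : w <= n by rewrite /w; lia.
have h3 : 2 * half_flips (inner K) <= a * (2 * n - a - 1) + 2 * ((w - a - 1) * B) by move: h1 h2; clear; lia.
case: (leqP (2 * n - a - 1) (2 * B)) => hB; [left|right].
  have q1 : a * (2 * n - a - 1) <= a * (2 * B) by rewrite leq_mul2l hB orbT.
  have q2 : (w - 1) * B = (w - a - 1) * B + a * B by rewrite -mulnDl; congr (_ * _); move: aw; clear; lia.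
  by rewrite q2; move: h3 q1; clear; lia.
have q1 : (w - a - 1) * (2 * B) <= (w - a - 1) * (2 * n) by rewrite leq_mul2l; move: hB; clear; lia.
have q2 : a * (2 * n - a - 1) <= a * (2 * n) by rewrite leq_mul2l; clear; lia.
have q3 : n * (w - 1) = (w - a - 1) * n + a * n by rewrite -mulnDl mulnC; congr (_ * _); move: aw; clear; lia.
by rewrite q3; move: h3 q1 q2; clear; lia.
Qed.

Definition outer K r := (r < K) || (#|V| - K <= r.+1).

Lemma half_flips_add (Q1 Q2 Q : pred nat) : (forall r, r.+1 < #|V| -> Q1 r + Q2 r = Q r :> nat) ->
  half_flips Q1 + half_flips Q2 = half_flips Q.
Proof.
move=> h; rewrite -big_split; apply: eq_bigr => t _; rewrite -big_split; apply: eq_bigr => x _.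
rewrite -big_split; apply: eq_bigr => y _ /=; case f: (flip t x y) => //=.
by rewrite h //; have [<- _ _] := rank_flip (in_setT x) (in_setT y) f; apply: rk_lt.
Qed.

Lemma half_flips_total K : half_flips (outer K) + half_flips (inner K) = half_flips predT.
Proof.
apply: half_flips_add => r _; rewrite /outer /inner ltnNge [#|V| - K <= _]leqNgt.
by case: (K <= r); case: (_ < _).
Qed.

Lemma half_flips_outer_border K : 0 < K -> 2 * K < #|V| ->
  half_flips (outer K.-1) + half_flips (border K) = half_flips (outer K).
Proof. by move=> K0 K2; apply: half_flips_add => r _; rewrite /outer /border; lia. Qed.

Lemma low_flips_outer K : 2 * K < #|V| -> low_flips [set: V] K = half_flips (outer K).
Proof.
move=> K2; rewrite -(@half_flips_add (fun r => r < K) (fun r => #|V| - K <= r.+1)); last first.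
  by move=> r; rewrite /outer; lia.
rewrite /low_flips (@big_cat_nat _ _ _ T) /=; [|lia|lia]; congr (_ + _).
  apply: eq_bigr => t _; under eq_bigl do rewrite inE; apply: eq_bigr => x _.
  by under eq_bigl do rewrite inE.
rewrite -{1}[T]add0n (_ : 2 * T = T + T) ?mul2n -?addnn // big_addn addnK.
apply: eq_bigr => t _; rewrite exchange_big; under eq_bigl do rewrite inE.
apply: eq_bigr => x _; under eq_bigl do rewrite inE; apply: eq_bigr => y _.
rewrite /low flipT; case f: (flip t x y) => //=.
have [r1 _ _] := rank_flip (in_setT x) (in_setT y) f.
have := rkD t y; have := rk_lt t y; rewrite r1.
move: (rank _ (t + T) y) (rank _ t x) #|V| => a b n h1 h2; congr nat_of_bool; lia.
Qed.

End Circular.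

(** * Circular sequences from swap times *)

(** A circular sequence is built from the initial order lt and from the step
    turn x y < T in which each pair swaps. The intermediate relations are
    transitive because, of three elements, the pair of the outer two swaps
    between the other pairs. *)
Section SwapTimes.
Variables (V : finType) (lt : rel V) (T : nat) (turn : V -> V -> nat).
Implicit Types (x y z w u v : V) (t : nat).
Hypothesis ltN : forall x y, x != y -> lt y x = ~~ lt x y.
Hypothesis lt_irr : forall x, lt x x = false.
Hypothesis lt_tr : forall x y z, lt x y -> lt y z -> lt x z.
Hypothesis turnC : forall x y, x != y -> turn y x = turn x y.
Hypothesis turn_lt : forall x y, x != y -> turn x y < T.
Hypothesis turn_inj : forall x y z w, x != y -> z != w -> turn x y = turn z w ->
  (x = z /\ y = w) \/ (x = w /\ y = z).
Hypothesis turn_between : forall x y z, lt x y -> lt y z ->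
  turn x y <= turn x z <= turn y z \/ turn y z <= turn x z <= turn x y.

Lemma lt_neq x y : lt x y -> x != y.
Proof. by apply: contraTneq => ->; rewrite lt_irr. Qed.

(** The number of swaps of the pair before time t. They take place in the
    steps congruent to turn x y modulo T, and the offset makes the quotient
    jump there. *)
Definition half_turns t x y : nat := (t + (T.-1 - turn x y)) %/ T.
Definition before t x y : bool := (x != y) && (lt x y (+) odd (half_turns t x y)).

Lemma half_turnsC t x y : x != y -> half_turns t y x = half_turns t x y.
Proof. by move=> n; rewrite /half_turns turnC. Qed.

Lemma half_turns_le t x y z w : (turn z w <= turn x y) -> (half_turns t x y <= half_turns t z w).
Proof. by move=> h; apply: leq_div2r; rewrite leq_add2l leq_sub2l. Qed.

Lemma half_turns_bounds t x y : x != y -> (t %/ T <= half_turns t x y <= (t %/ T).+1).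
Proof.
move=> n; have p0 : (0 < T) := leq_ltn_trans (leq0n _) (turn_lt n).
apply/andP; split; first by apply: leq_div2r; rewrite leq_addr.
rewrite /half_turns -ltnS ltn_divLR // 2!mulSn {1}(divn_eq t T).
have := ltn_pmod t p0; have := turn_lt n; move: (t %/ T * T) => a; lia.
Qed.

Lemma half_turnsS t x y : x != y ->
  half_turns t.+1 x y = ((T %| (t + (T.-1 - turn x y)).+1) + half_turns t x y).
Proof.
by move=> n; rewrite /half_turns addSn divnS // (leq_ltn_trans (leq0n _) (turn_lt n)).
Qed.

Lemma half_turnsT t x y : x != y -> half_turns (t + T) x y = (half_turns t x y).+1.
Proof.
move=> n; have p0 : (0 < T) := leq_ltn_trans (leq0n _) (turn_lt n).
by rewrite /half_turns addnAC divnDr // divnn p0 addn1.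
Qed.

Lemma half_turns_mono s t x y : (s <= t) -> (half_turns s x y <= half_turns t x y).
Proof. by move=> h; apply: leq_div2r; rewrite leq_add2r. Qed.

Lemma half_turns_middle t x y z : lt x y && lt y z ==>
  (odd (half_turns t x z) == odd (half_turns t x y)) ||
  (odd (half_turns t x z) == odd (half_turns t y z)).
Proof.
apply/implyP => /andP[xy yz].
have b1 := half_turns_bounds t (lt_neq xy); have b2 := half_turns_bounds t (lt_neq yz).
have [->|->] : half_turns t x z = half_turns t x y \/ half_turns t x z = half_turns t y z.
- case: (turn_between xy yz) => /andP[/(half_turns_le t) l1 /(half_turns_le t) l2];
  move: b1 b2 l1 l2; move: (half_turns t x y) (half_turns t x z) (half_turns t y z) => a b c;
  clear; lia.
- by rewrite eqxx.
- by rewrite eqxx orbT.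
Qed.

(** Here p, q, r are the initial orders of xy, yz, xz, and a, b, c say whether
    these pairs are reversed. Each of the last six premises treats one initial
    order of x, y, z: the outer pair is reversed like one of the others. *)
Lemma bool_order_trans (p q r a b c : bool) :
  p && q ==> r -> ~~ q && ~~ p ==> ~~ r ->
  p && q ==> (c == a) || (c == b) -> ~~ q && ~~ p ==> (c == b) || (c == a) ->
  ~~ p && r ==> (b == a) || (b == c) -> ~~ r && p ==> (b == c) || (b == a) ->
  r && ~~ q ==> (a == c) || (a == b) -> q && ~~ r ==> (a == b) || (a == c) ->
  p (+) a -> q (+) b -> r (+) c.
Proof. by case: p; case: q; case: r; case: a; case: b; case: c. Qed.

Lemma circular_before : circular T before.
Proof.
split.
- by move=> t x; rewrite /before eqxx.
- move=> t x y z /andP[nxy bxy] /andP[nyz byz].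
  have nxz : x != z.
    apply: contraTneq byz => e; move: bxy; rewrite e (ltN nyz) (half_turnsC t nyz).
    by case: (lt _ _); case: (odd _).
  have nyx : y != x by rewrite eq_sym.
  have nzy : z != y by rewrite eq_sym.
  have nzx : z != x by rewrite eq_sym.
  have m1 := half_turns_middle t x y z; have m2 := half_turns_middle t z y x.
  have m3 := half_turns_middle t y x z; have m4 := half_turns_middle t z x y.
  have m5 := half_turns_middle t x z y; have m6 := half_turns_middle t y z x.
  move: m1 m2 m3 m4 m5 m6 bxy byz; rewrite /before nxz /=.
  rewrite !(half_turnsC _ nxy) !(half_turnsC _ nyz) !(half_turnsC _ nxz).
  rewrite !(ltN nxy) !(ltN nyz) !(ltN nxz).
  apply: bool_order_trans; first by apply/implyP => /andP[/lt_tr h /h].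
  rewrite -!ltN //; by apply/implyP => /andP[/lt_tr h /h].
- move=> t x y n; rewrite /before n eq_sym n /= (half_turnsC t n) (ltN n).
  by case: (lt _ _); case: (odd _).
- move=> t x y; rewrite /before [y == x]eq_sym; case: (eqVneq x y) => //= n.
  rewrite (ltN n) (half_turnsC t n) (half_turnsT t n) /=.
  by case: (lt _ _); case: (odd _).
- move=> t x y z w /andP[nxy b1] /andP[_ b2] /andP[nzw b3] /andP[_ b4].
  have p0 : (0 < T) := leq_ltn_trans (leq0n _) (turn_lt nxy).
  have d u v : u != v -> lt u v (+) odd (half_turns t u v) ->
      lt v u (+) odd (half_turns t.+1 v u) -> (T %| (t + (T.-1 - turn u v)).+1).
    move=> n; rewrite (ltN n) (half_turnsC _ n) (half_turnsS _ n).
    by case: (_ %| _) => //=; case: (lt _ _); case: (odd _).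
  have d1 := d x y nxy b1 b2; have d2 := d z w nzw b3 b4.
  have tt : turn x y = turn z w.
    have t1 := turn_lt nxy; have t2 := turn_lt nzw.
    have : (t.+1 + (T.-1 - turn x y) == t.+1 + (T.-1 - turn z w) %[mod T]).
      by rewrite !addSn (eqP d1) (eqP d2).
    by rewrite eqn_modDl !modn_small; [move/eqP| |]; move: t1 t2; clear; lia.
  case: (turn_inj nxy nzw tt) => [//|[exw eyz]]; move: b1 b3.
  rewrite exw eyz (ltN nzw) (half_turnsC t nzw).
  by case: (lt _ _); case: (odd _).
- move=> s u t x y su ut ts /andP[n b1] /andP[_ b2]; rewrite /before n /=.
  have h1 := half_turns_mono x y su; have h2 := half_turns_mono x y ut.
  have h3 := half_turns_mono x y ts; rewrite (half_turnsT s n) in h3.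
  have e : half_turns u x y = half_turns s x y.
    move: b1 b2 h1 h2 h3; move: (half_turns s x y) (half_turns u x y) (half_turns t x y) => a b c.
    case: (lt _ _) => /= o1 o2 h1 h2 h3; have : c = a \/ c = a.+1 by lia.
      by case=> e; [lia|move: o1 o2; rewrite e /= => ->].
    by case=> e; [lia|move: o1 o2; rewrite e /= => ->].
  by rewrite e.
Qed.

Lemma before_flip t x y : t < T -> flip before t x y = lt x y && (t == turn x y).
Proof.
move=> tT; rewrite /flip /before [y == x]eq_sym.
case: (eqVneq x y) => [->|n] /=; first by rewrite lt_irr.
have tn := turn_lt n.
rewrite (ltN n) (half_turnsC _ n) (half_turnsS _ n).
have := half_turns_bounds t n; rewrite divn_small // => b.
have [e|ne] := eqVneq t (turn x y).
  have -> : half_turns t x y = 0 by rewrite /half_turns divn_small //; lia.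
  rewrite (_ : (t + _).+1 = T) ?dvdnn; last by lia.
  by case: (lt x y).
have -> : (T %| (t + (T.-1 - turn x y)).+1) = false.
  apply/negP => /dvdnP[[|[|q]]]; rewrite ?mulSn; lia.
by rewrite andbF; case: (lt x y); case: (odd _).
Qed.

Lemma before_turn x y z : lt x y -> before (turn x y) z x =
  (z != x) && (if lt z x then turn x y <= turn z x else turn x z < turn x y).
Proof.
move=> xy; rewrite /before; case: (eqVneq z x) => //= n.
have tn := turn_lt n; have txy := turn_lt (lt_neq xy).
have -> : half_turns (turn x y) z x = (turn z x < turn x y).
  rewrite /half_turns; case: ltnP => h; last by rewrite divn_small //; lia.
  rewrite (_ : _ + _ = T + (turn x y - (turn z x).+1)); last by lia.
  rewrite divnDl ?dvdnn // divnn divn_small; lia.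
by rewrite oddb (turnC n) [turn x y <= _]leqNgt; case: (lt z x).
Qed.

End SwapTimes.

Import Order.TTheory GRing.Theory Num.Theory.

Local Open Scope ring_scope.

(** * The circular sequence of a point set *)

Section Geometry.
Variables (R : realType) (P : {fset R * R}).
Hypothesis gp : general_position P.
Local Notation V := (fset_sub_type P).
Implicit Types (x y z w : V) (t : nat).

(** The shear by tilt makes the abscissas of the points distinct, because tilt
    exceeds every |dx / dy|; a shear does not change orient. *)
Definition tilt : R := 1 + \sum_(x : V) \sum_(y : V) `|((val y).1 - (val x).1) / ((val y).2 - (val x).2)|.
Definition absc (p : R * R) : R := p.1 + tilt * p.2.

Lemma absc_inj x y : absc (val x) = absc (val y) -> x = y.
Proof.
rewrite /absc => e; apply/val_inj.
have e1 : (val y).1 - (val x).1 = - tilt * ((val y).2 - (val x).2) by lra.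
case: (eqVneq (val x).2 (val y).2) => [e2|n].
  move: e1; rewrite e2 subrr mulr0 => /eqP; rewrite subr_eq0 => /eqP e1.
  by case: (val x) (val y) e1 e2 => [a b] [c d] /= -> ->.
have d0 : (val y).2 - (val x).2 != 0 by rewrite subr_eq0 eq_sym.
have : `|((val y).1 - (val x).1) / ((val y).2 - (val x).2)| < tilt.
  rewrite /tilt (bigD1 x) //= (bigD1 y) //=.
  set A := \sum_(i | _) _; set B := \sum_(i | _) _; set q := `|_|.
  have A0 : 0 <= A by apply: sumr_ge0.
  have B0 : 0 <= B by apply: sumr_ge0 => i _; apply: sumr_ge0.
  lra.
rewrite e1 mulfK // normrN => /lt_le_trans /(_ (ler_norm _)); by rewrite ltxx.
Qed.

Definition slope (e : V * V) : R :=
  ((val e.2).2 - (val e.1).2) / (absc (val e.2) - absc (val e.1)).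

Lemma orient_absc (p q r : R * R) : orient p q r =
  (absc q - absc p) * (r.2 - p.2) - (q.2 - p.2) * (absc r - absc p).
Proof. by rewrite /orient /absc; ring. Qed.

Lemma orientC (p q r : R * R) : orient q p r = - orient p q r.
Proof. by rewrite /orient; ring. Qed.

Lemma orient_neq0 x y z : x != y -> y != z -> x != z -> orient (val x) (val y) (val z) != 0.
Proof.
move=> xy yz xz; apply/eqP => h.
apply: (gp (valP x) (valP y) (valP z)) h; by rewrite (inj_eq val_inj).
Qed.

Local Notation X x := (absc (val x)).

Lemma slope_lt a b c d : X a < X b -> X c < X d -> (slope (a, b) < slope (c, d)) =
  (((val b).2 - (val a).2) * (X d - X c) < ((val d).2 - (val c).2) * (X b - X a)).
Proof.
move=> ab cd; rewrite /slope /= ltr_pdivrMr ?subr_gt0 // mulrAC ltr_pdivlMr ?subr_gt0 //.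
Qed.

(** Parallel lines are left in the order that sort gives them. This is
    harmless: lines with a common point have different slopes, and no other
    lines need to be compared. *)
Definition edges : seq (V * V) :=
  sort (fun e f => slope e <= slope f) [seq e <- enum {: V * V} | X e.1 < X e.2].

Definition period : nat := size edges.
Definition sorted_pair x y := if X x < X y then (x, y) else (y, x).
Definition turn x y : nat := index (sorted_pair x y) edges.

Lemma mem_edges e : (e \in edges) = (X e.1 < X e.2).
Proof. by rewrite mem_sort mem_filter mem_enum andbT. Qed.

Lemma absc_neq x y : x != y -> (X y < X x) = ~~ (X x < X y).
Proof.
move=> n; rewrite -leNgt le_eqVlt; case: eqP => // e.
by rewrite (absc_inj (esym e)) eqxx in n.
Qed.

Lemma sorted_pairC x y : x != y -> sorted_pair y x = sorted_pair x y.
Proof. by move=> n; rewrite /sorted_pair absc_neq //; case: (X x < X y). Qed.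

Lemma turnC x y : x != y -> turn y x = turn x y.
Proof. by move=> n; rewrite /turn sorted_pairC. Qed.

Lemma mem_sorted_pair x y : x != y -> sorted_pair x y \in edges.
Proof.
by move=> n; rewrite mem_edges /sorted_pair; case: ifPn => //=; rewrite -absc_neq.
Qed.

Lemma turn_lt x y : x != y -> (turn x y < period)%N.
Proof. by move=> n; rewrite index_mem mem_sorted_pair. Qed.

Lemma turn_slope e f : e \in edges -> f \in edges -> slope e < slope f ->
  (index e edges < index f edges)%N.
Proof.
move=> he hf ef; rewrite ltn_neqAle; apply/andP; split.
  by apply: contraTneq ef => /(index_inj e he hf) ->; rewrite ltxx.
rewrite leqNgt; apply/negP=> h.
have : slope f <= slope e.
  apply: (@sorted_ltn_index _ (fun e f => slope e <= slope f)) h => //.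
    by move=> a b c; apply: le_trans.
  by apply: sort_sorted => a b; apply: le_total.
by rewrite leNgt ef.
Qed.

Local Opaque edges tilt absc.
Lemma turn_inj x y z w : x != y -> z != w -> turn x y = turn z w ->
  (x = z /\ y = w) \/ (x = w /\ y = z).
Proof.
move=> xy zw /(index_inj (x, y) (mem_sorted_pair xy) (mem_sorted_pair zw)).
clear xy zw.
rewrite /sorted_pair; case: (X x < X y); case: (X z < X w) => -[-> ->];
[left|right|right|left]; split; reflexivity.
Qed.

Lemma turn_edge x y : X x < X y -> turn x y = index (x, y) edges.
Proof. by rewrite /turn /sorted_pair => ->. Qed.

Lemma absc_lt_neq x y : X x < X y -> x != y.
Proof. by apply: contraTneq => ->; rewrite ltxx. Qed.

(** Turning a line about one of its points x, the side of the line on which z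
    lies decides whether z is met before y. *)
Lemma turn_left x y z : X x < X y -> X z < X x ->
  (turn x y < turn z x)%N = (orient (val x) (val y) (val z) < 0).
Proof.
move=> xy zx; have zy := lt_trans zx xy.
have s1 : (slope (x, y) < slope (z, x)) = (orient (val x) (val y) (val z) < 0).
  by rewrite slope_lt // orient_absc; apply/idP/idP => h; lra.
have s2 : (slope (z, x) < slope (x, y)) = (0 < orient (val x) (val y) (val z)).
  by rewrite slope_lt // orient_absc; apply/idP/idP => h; lra.
have o0 : orient (val x) (val y) (val z) != 0.
  by apply: orient_neq0; rewrite ?(absc_lt_neq xy) // eq_sym ?(absc_lt_neq zx) ?(absc_lt_neq zy).
rewrite !turn_edge // -s1; apply/idP/idP => [h|]; last by apply: turn_slope; rewrite mem_edges.
rewrite s1 lt_neqAle o0 leNgt -s2; apply/negP => lt.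
by have := turn_slope _ _ lt; rewrite !mem_edges => /(_ zx xy); rewrite ltnNge (ltnW h).
Qed.

Lemma turn_right x y z : X x < X y -> X x < X z -> y != z ->
  (turn x z < turn x y)%N = (orient (val x) (val y) (val z) < 0).
Proof.
move=> xy xz yz.
have s1 : (slope (x, z) < slope (x, y)) = (orient (val x) (val y) (val z) < 0).
  by rewrite slope_lt // orient_absc; apply/idP/idP => h; lra.
have s2 : (slope (x, y) < slope (x, z)) = (0 < orient (val x) (val y) (val z)).
  by rewrite slope_lt // orient_absc; apply/idP/idP => h; lra.
have o0 : orient (val x) (val y) (val z) != 0.
  by apply: orient_neq0; rewrite ?(absc_lt_neq xy) ?(absc_lt_neq xz).
rewrite !turn_edge // -s1; apply/idP/idP => [h|]; last by apply: turn_slope; rewrite mem_edges.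
rewrite s1 lt_neqAle o0 leNgt -s2; apply/negP => lt.
by have := turn_slope _ _ lt; rewrite !mem_edges => /(_ xy xz); rewrite ltnNge (ltnW h).
Qed.

Local Notation before := (before (fun x y : V => X x < X y) period turn).

(** In a triangle, the slope of the side with the longest projection is a mean
    of the two other slopes. *)
Lemma turn_between x y z : X x < X y -> X y < X z ->
  (turn x y <= turn x z <= turn y z)%N \/ (turn y z <= turn x z <= turn x y)%N.
Proof.
move=> xy yz; have xz := lt_trans xy yz.
have o0 := orient_neq0 (absc_lt_neq xy) (absc_lt_neq yz) (absc_lt_neq xz).
rewrite !turn_edge //; case: (ltgtP 0 (orient (val x) (val y) (val z))) o0 => // o _; [left|right];
by apply/andP; split; apply: ltnW; apply: turn_slope; rewrite ?mem_edges // slope_lt //;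
  move: o; rewrite orient_absc => o; lra.
Qed.

Lemma before_circular : circular period before.
Proof.
apply: circular_before.
- exact: absc_neq.
- by move=> x; rewrite ltxx.
- by move=> x y z; apply: lt_trans.
- exact: turnC.
- exact: turn_lt.
- exact: turn_inj.
- exact: turn_between.
Qed.

Definition below x y := #|[set z : V | orient (val x) (val y) (val z) < 0]|.

Lemma absc_lt_asym x y : X x < X y -> (X y < X x) = false.
Proof. by move=> h; rewrite (absc_neq (absc_lt_neq h)) h. Qed.

Lemma orient_at_first (p q : R * R) : orient p q p = 0.
Proof. by rewrite /orient; ring. Qed.

Lemma orient_at_second (p q : R * R) : orient p q q = 0.
Proof. by rewrite /orient; ring. Qed.

Lemma rank_turn x y : X x < X y -> rank before [set: V] (turn x y) x = below x y.
Proof.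
move=> xy; apply: eq_card => z; rewrite !inE.
rewrite (before_turn (fun x => ltxx _) turnC turn_lt (lt := fun x y : V => X x < X y)) //.
case: (eqVneq z x) => [->|nzx] /=; first by rewrite orient_at_first ltxx.
case: (eqVneq z y) => [->|nzy]; first by rewrite (absc_lt_asym xy) orient_at_second !ltxx ltnn.
case: ifP => zx.
  rewrite -(turn_left xy zx) leq_eqVlt; case: eqP => //= e.
  have nyx : x != y := absc_lt_neq xy.
  by case: (turn_inj nyx nzx e) => -[h1 h2]; rewrite -?h1 -?h2 eqxx in nzx nzy.
have xz : X x < X z by rewrite (absc_neq nzx) zx.
by rewrite (turn_right xy xz) // eq_sym.
Qed.

Lemma half_before (Q : pred nat) :
  half_flips period before Q = (\sum_x \sum_y ((X x < X y)%R && Q (below x y)))%N.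
Proof.
rewrite /half_flips exchange_big; apply: eq_bigr => x _; rewrite exchange_big; apply: eq_bigr => y _.
rewrite big_nat; under eq_bigr => t /andP[_ tT].
  rewrite (before_flip absc_neq (fun x => ltxx _) turnC turn_lt) //; over.
rewrite -big_nat; case xy: (X x < X y) => /=; last by rewrite big1.
rewrite big_mkord (bigD1 (Ordinal (turn_lt (absc_lt_neq xy)))) //= eqxx rank_turn //=.
rewrite big1 ?addn0 // => t nt; case: eqP => //= e.
by case/eqP: nt; apply/val_inj.
Qed.

(** * Lines as swaps *)

Lemma card_right x y : #|` right_pts P (val x) (val y)| = below x y.
Proof.
rewrite -(@card_fsub _ P); last by apply/fsubsetP => r; rewrite !inE => /andP[].
by apply: eq_card => z; rewrite in_fsub !inE /= (valP z).
Qed.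

Lemma card_left x y : x != y -> (#|` left_pts P (val x) (val y)| + (below x y).+2)%N = #|` P|.
Proof.
move=> nxy; rewrite -(@card_fsub _ P (left_pts _ _ _)); last by apply/fsubsetP => r; rewrite !inE => /andP[].
have nyx : y != x by rewrite eq_sym.
have -> : fsub P (left_pts P (val x) (val y)) =
    ~: (x |: (y |: [set z : V | orient (val x) (val y) (val z) < 0])).
  apply/setP => z; rewrite in_fsub !inE /= (valP z) /= !negb_or -leNgt.
  case: (eqVneq z x) => [->|nzx] /=; first by rewrite orient_at_first ltxx.
  case: (eqVneq z y) => [->|nzy] /=; first by rewrite orient_at_second ltxx.
  rewrite lt_def orient_neq0 //; by rewrite eq_sym.
have := cardsC (x |: (y |: [set z : V | orient (val x) (val y) (val z) < 0])).
rewrite !cardsU1 !inE orient_at_first orient_at_second ltxx (negPf nxy) /= -/(below x y) cardfE.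
by rewrite -cardsT => <-; rewrite addnC.
Qed.

Definition edge_of k (e : V * V) := (X e.1 < X e.2) &&
  ((#|` left_pts P (val e.1) (val e.2)| == k) || (#|` right_pts P (val e.1) (val e.2)| == k)).

Lemma line_left (p q : R * R) : line p q p.
Proof. exact: orient_at_first. Qed.

Lemma line_right (p q : R * R) : line p q q.
Proof. exact: orient_at_second. Qed.

Lemma on_line x y z : x != y -> line (val x) (val y) (val z) -> z = x \/ z = y.
Proof.
move=> nxy l; case: (eqVneq z x) => [|nzx]; first by left.
case: (eqVneq z y) => [|nzy]; first by right.
have := @orient_neq0 x y z nxy; rewrite eq_sym nzy eq_sym nzx => /(_ isT isT).
by rewrite (l : orient _ _ _ = 0) eqxx.
Qed.

(** No line contains a third point, so a line determines its pair. *)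
Lemma line_inj : {in [pred e : V * V | X e.1 < X e.2] &,
  injective (fun e : V * V => line (val e.1) (val e.2))}.
Proof.
move=> [x y] [z w]; rewrite !inE /= => xy zw e.
have nxy := absc_lt_neq xy; have nzw := absc_lt_neq zw.
have h1 : z = x \/ z = y by apply: on_line => //; rewrite e; apply: line_left.
have h2 : w = x \/ w = y by apply: on_line => //; rewrite e; apply: line_right.
case: h1 => h1; case: h2 => h2; subst z w => //.
- by rewrite ltxx in zw.
- by rewrite (absc_lt_asym xy) in zw.
- by rewrite ltxx in zw.
Qed.

Lemma lineC (p q : R * R) : line q p = line p q.
Proof.
by apply/funext => r; apply/propext; rewrite /line /= orientC; split=> h; lra.
Qed.

Lemma left_ptsC (p q : R * R) : left_pts P q p = right_pts P p q.
Proof. by apply/fsetP => r; rewrite !inE orientC oppr_gt0. Qed.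

Lemma right_ptsC (p q : R * R) : right_pts P q p = left_pts P p q.
Proof. by rewrite left_ptsC. Qed.

Lemma kedges_edge k : kedges k P =
  [fset line (val e.1) (val e.2) | e in [pred e : V * V | edge_of k e]]%fset.
Proof.
apply/fsetP => l; apply/imfsetP/imfsetP => /= -[e].
  rewrite !inE => /andP[/andP[p1 p2] /andP[n c]] ->.
  pose x : V := FSetSub p1; pose y : V := FSetSub p2.
  have nxy : x != y by rewrite -(inj_eq val_inj).
  case xy: (X x < X y).
    have m : edge_of k (x, y) by rewrite /edge_of xy.
    by exists (x, y); [exact: m|].
  have m : edge_of k (y, x) by rewrite /edge_of (absc_neq nxy) xy (left_ptsC (val x)) (right_ptsC (val x)) orbC.
  by exists (y, x); [exact: m|rewrite lineC].
move=> he ->; have {he} /andP[xy c] : edge_of k e := he; exists (val e.1, val e.2) => //.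
have k1 : val e.1 \in P := valP _; have k2 : val e.2 \in P := valP _.
by rewrite inE /= in_fsetM /= k1 k2 (inj_eq val_inj) (absc_lt_neq xy).
Qed.

Lemma E_count k : E k P = (\sum_x \sum_y ((X x < X y)%R &&
   ((below x y + k.+2 == #|` P|) || (below x y == k))))%N.
Proof.
rewrite /E kedges_edge card_in_imfset; last first.
  by move=> e f /andP[he _] /andP[hf _]; apply: line_inj.
rewrite /= -cardE -sum1_card pair_big /= big_mkcond /=; apply: eq_bigr => -[x y] _.
rewrite (_ : ((x, y) \in _) = edge_of k (x, y)) // /edge_of /=.
case xy: (X x < X y) => //=; rewrite card_right -(card_left (absc_lt_neq xy)).
have -> : (below x y + k.+2 == #|` left_pts P (val x) (val y)| + (below x y).+2)%N =
  (#|` left_pts P (val x) (val y)| == k).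
  by move: (below x y) #|` _| => b l; lia.
by case: (_ || _).
Qed.

Lemma below_lt x y : x != y -> ((below x y).+2 <= #|` P|)%N.
Proof. by move=> /card_left <-; rewrite leq_addl. Qed.

Lemma sum_nat_eq b K : (\sum_(0 <= j < K) (b == j) = (b < K))%N.
Proof.
elim: K => [|K IH]; first by rewrite big_geq.
by rewrite big_nat_recr //= IH; case: (ltngtP b K) => h; lia.
Qed.

(** The index K stands for k + 1, which makes room for the empty sum at k = -
    1. *)
Definition few_edges K := half_flips period before (outer V K).

Lemma Ele_few_edges K : (2 * K < #|` P|)%N -> Ele (K%:Z - 1) P = few_edges K.
Proof.
move=> K2; rewrite /few_edges half_before.
have -> : Ele (K%:Z - 1) P = (\sum_(0 <= j < K) E j P)%N.
  case: K {K2} => [|K]; first by rewrite big_geq.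
  by rewrite (_ : K.+1%:Z - 1 = K%:Z) //; lia.
under eq_bigr do rewrite E_count.
rewrite exchange_big; apply: eq_bigr => x _; rewrite exchange_big; apply: eq_bigr => y _ /=.
case xy: (X x < X y); last by rewrite big1.
have := below_lt (absc_lt_neq xy); rewrite /outer -cardfE.
move: (below x y) #|` P| K2 => b n K2 bn /=.
have -> : (\sum_(0 <= j < K) ((b + j.+2 == n) || (b == j)) =
   \sum_(0 <= j < K) (b == j) + \sum_(0 <= j < K) (n - b.+2 == j))%N.
  by rewrite -big_split !big_nat; apply: eq_bigr => j /= jK; lia.
rewrite !sum_nat_eq; lia.
Qed.

Lemma half_flips_all : half_flips period before predT = 'C(#|` P|, 2).
Proof.
rewrite half_before.
have tw : ((\sum_x \sum_y ((X x < X y)%R && predT (below x y))) * 2 = #|` P| * #|` P|.-1)%N.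
  rewrite muln2 -addnn [Z in (_ + Z)%N]exchange_big -big_split /=.
  rewrite cardfE -[RHS]sum_nat_const; apply: eq_bigr => x _.
  rewrite -big_split /= -(cardC1 x) -sum1_card [RHS]big_mkcond; apply: eq_bigr => y _.
  rewrite !andbT inE eq_sym; case: (eqVneq x y) => [->|n]; first by rewrite ltxx.
  by rewrite (absc_neq n); case: (X x < X y).
apply/eqP; rewrite -(eqn_pmul2r (isT : (0 < 2)%N)) tw.
by have := mul_bin_left #|` P| 1; rewrite bin1 subn1 => e; apply/eqP; lia.
Qed.

Lemma few_edges_lb K : (2 * K < #|` P|)%N ->
  (3 * 'C(K.+1, 2) + excess #|` P| K <= few_edges K)%N.
Proof.
move=> K2; rewrite /few_edges -(low_flips_outer before_circular) -?cardfE // cardfE -cardsT.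
by apply: (low_flips_lb before_circular); rewrite cardsT -cardfE.
Qed.

(** The swaps at the border for K are the (K - 1)-edges, and those inside the
    window are the k-edges with k at least K. *)
Lemma few_edges_step K : (0 < K)%N -> (2 * K < #|` P|)%N ->
  (few_edges K.-1 <= few_edges K)%N /\
  (('C(#|` P|, 2) <= few_edges K + (#|` P| - 2 * K - 1) * (few_edges K - few_edges K.-1))%N \/
   ('C(#|` P|, 2) <= few_edges K + #|` P| * (#|` P| - 2 * K - 1))%N).
Proof.
move=> K0 K2; have K2' : (2 * K < #|{: V}|)%N by rewrite -cardfE.
have h1 := half_flips_outer_border before_circular K0 K2'.
have h2 := half_flips_total before_circular K; rewrite half_flips_all in h2.
rewrite /few_edges -h2 -h1 addKn leq_addr; split=> //.
by case: (window_flips before_circular K0 K2'); rewrite -cardfE => h; [left|right]; rewrite leq_add2l.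
Qed.

End Geometry.

(** * The recursion *)

Lemma excess_closed n M : (n %/ 3 <= M)%N ->
  (excess n M + (M - n %/ 3) * (n - 3 * (n %/ 3)) = 3 * 'C(M.+1 - n %/ 3, 2))%N.
Proof.
set h := (n %/ 3)%N => hM; rewrite -(subnKC hM); move: (M - h)%N => d.
have hn : (3 * h <= n <= 3 * h + 2)%N by rewrite /h; lia.
have e0 : excess n h = 0%N.
  by rewrite /excess big_nat big1 // => j; lia.
rewrite addKn -addnS addKn; elim: d => [|d IH]; first by rewrite addn0 e0.
have -> : excess n (h + d.+1) = (excess n (h + d) + (3 * (h + d.+1) - n))%N.
  by rewrite addnS {1}/excess big_nat_recr.
rewrite mulSn binS bin1; move: IH hn; move: ('C(_, _)) (excess _ _) => b e; lia.
Qed.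

(** Here M is (4 n - 11) / 9 rounded up and u2 is twice the first value of the
    recursion. To leading order this first value is 17 n ^ 2 / 54, and n (n -
    2 M - 2) is 6 n ^ 2 / 54, so their sum stays below the number n ^ 2 / 2 of
    all pairs. *)
Lemma base_gap n M u2 : (4 * n <= 9 * M + 11)%N -> (9 * M + 3 <= 4 * n)%N -> (2 * M + 3 <= n)%N ->
  (u2 + 2 * (M - n %/ 3) * (n - 3 * (n %/ 3)) =
     3 * M * M.+1 + 3 * (M - n %/ 3) * (M - n %/ 3).+1)%N ->
  (u2 + 2 * n * (n - 2 * M - 2) <= n * n.-1)%N.
Proof.
have hE : exists h, (n %/ 3 = h /\ 3 * h <= n <= 3 * h + 2)%N by exists (n %/ 3)%N; split=> //; lia.
case: hE => h [-> hn] h1 h2 h3.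
have [dM nE] : exists d, M = (h + d)%N /\ exists r, (n = 3 * h + r)%N by exists (M - h)%N; split; [lia|exists (n - 3 * h)%N; lia].
case: nE => ME [r nE].
have [g gE] : exists g, n = (2 * M + 2 + g)%N by exists (n - 2 * M - 2)%N; lia.
have -> : (n - 2 * M - 2 = g)%N by lia.
have -> : (M - h = dM)%N by lia.
have -> : (n - 3 * h = r)%N by lia.
have rr : r = 0%N \/ r = 1%N \/ r = 2%N by lia.
have -> : (n.-1 = n - 1)%N by lia.
subst M; have hh : (h = 2 * dM + 2 + g - r)%N by lia.
have {}gE : (r + h = 2 * dM + 2 + g)%N by lia.
have q1 : (3 * dM <= h + 4)%N by lia.
case: rr => [|[|]] rE; subst r n; nia.
Qed.

Lemma double_bin2 j : (2 * 'C(j, 2) = j * j.-1)%N.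
Proof. by have := mul_bin_left j 1; rewrite bin1 subn1 mulnC => ->; rewrite mulnC. Qed.

Lemma start_gap n M : (n %/ 3 <= M)%N -> (4 * n <= 9 * M + 11)%N -> (9 * M + 3 <= 4 * n)%N ->
  (2 * M + 3 <= n)%N ->
  (3 * 'C(M.+1, 2) + excess n M + n * (n - 2 * M - 2) <= 'C(n, 2))%N.
Proof.
move=> hM Mlo Mhi M3; rewrite -(leq_pmul2l (isT : (0 < 2)%N)) double_bin2 mulnDr mulnA.
apply: (base_gap Mlo Mhi M3).
have := excess_closed hM; rewrite subSn //.
have := double_bin2 M.+1; have := double_bin2 (M - n %/ 3).+1.
move: 'C(M.+1, 2) 'C((M - n %/ 3).+1, 2) (excess _ _) (M - n %/ 3)%N (n - 3 * _)%N => a b x d r /=; nia.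
Qed.

(** With w = n - 2 K, the first alternative for U is the recursion itself. The
    second one says that U K is at least C(n, 2) - n (w - 1), so it remains to
    keep u below this value. This is done by the recursion: if u at K - 1 is
    at most c = C(n, 2) - n w, then C(n, 2) + (w - 1) c = w (C(n, 2) - n (w -
    1)). *)
Lemma recursion_bound (n M : nat) (u : nat -> int) (U : nat -> nat) :
  ((2 * M < n)%N -> u M <= (U M)%:Z) ->
  ((2 * M + 3 <= n)%N -> u M + (n * (n - 2 * M - 2))%N%:Z <= 'C(n, 2)%:Z) ->
  (forall K (z : int), (M < K)%N -> (2 * K < n)%N ->
     'C(n, 2)%:Z + (n - 2 * K - 1)%N%:Z * u K.-1 <= (n - 2 * K)%N%:Z * z -> u K <= z) ->
  (forall K, (0 < K)%N -> (2 * K < n)%N -> (U K.-1 <= U K)%N /\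
    (('C(n, 2) <= U K + (n - 2 * K - 1) * (U K - U K.-1))%N \/
     ('C(n, 2) <= U K + n * (n - 2 * K - 1))%N)) ->
  forall K, (M <= K)%N -> (2 * K < n)%N -> u K <= (U K)%:Z.
Proof.
move=> base gap least step K MK.
suff : (2 * K < n)%N -> u K <= (U K)%:Z /\
    ((2 * K + 3 <= n)%N -> u K + (n * (n - 2 * K - 2))%N%:Z <= 'C(n, 2)%:Z).
  by move=> h Kn; case: (h Kn).
rewrite -(subnKC MK); elim: (K - M)%N => [|d IH]; first by rewrite addn0 => h; split; [exact: base|exact: gap].
rewrite addnS; set L := (M + d)%N in IH *; move=> Ln.
have [uL gL] : u L <= (U L)%:Z /\
  ((2 * L + 3 <= n)%N -> u L + (n * (n - 2 * L - 2))%N%:Z <= 'C(n, 2)%:Z) by apply: IH; lia.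
have {}gL := gL (_ : (2 * L + 3 <= n)%N).
have ML : (M < L.+1)%N by rewrite ltnS leq_addr.
have [w wE] : exists w, (n - 2 * L.+1 = w.+1)%N by exists (n - 2 * L.+1).-1; lia.
have w1 : (n - 2 * L.+1 - 1 = w)%N by lia.
have w2 : (n - 2 * L - 2 = w.+1)%N by lia.
have w3 : (n - 2 * L.+1 - 2 = w.-1)%N by lia.
have lst z := least L.+1 z ML Ln.
have [U01 st] := step L.+1 isT Ln.
rewrite w1 wE /= in lst; rewrite w1 /= in st; rewrite /= in U01; rewrite w2 in gL; rewrite w3.
have {}gL : u L + (n * w.+1)%N%:Z <= 'C(n, 2)%:Z by apply: gL; lia.
(* The bound that settles the second alternative; it also carries the
   induction. *)
have strong : u L.+1 <= 'C(n, 2)%:Z - (n * w)%N%:Z.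
  apply: lst; move: gL; move: (u L) 'C(n, 2)%:Z => a c gL; rewrite !PoszM.
  have : w%:Z * (a + n%:Z * w.+1%:Z) <= w%:Z * c by apply: ler_wpM2l.
  rewrite -[w.+1]addn1 !PoszD; move: w%:Z n%:Z => w' n'; lra.
split; last first.
  move=> _; apply: le_trans (_ : u L.+1 + (n * w)%N%:Z <= _); last by lra.
  by rewrite lerD2l lez_nat leq_mul2l leq_pred orbT.
case: st => st; last by apply: le_trans strong _; lia.
apply: lst.
have : w%:Z * u L <= w%:Z * (U L)%:Z by apply: ler_wpM2l.
have : 'C(n, 2)%:Z <= (U L.+1)%:Z + w%:Z * ((U L.+1)%:Z - (U L)%:Z).
  by rewrite subzn // -PoszM -PoszD lez_nat.
rewrite -[w.+1]addn1 PoszD; move: (u L) (U L)%:Z (U L.+1)%:Z 'C(n, 2)%:Z w%:Z => a b c e w'; lra.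
Qed.

Lemma mstart_bounds n M : mstart n = M%:Z -> (4 * n <= 9 * M + 11)%N /\ (9 * M + 3 <= 4 * n)%N.
Proof.
move=> ME; split.
  have : ((4 * n%:R - 11) / 9 : rat) <= (mstart n)%:~R by apply: ceil_ge.
  rewrite ME ler_pdivrMr // -!pmulrn => h; rewrite -(ler_nat rat) natrD !natrM.
  by move: h; move: (n%:R : rat) (M%:R : rat) => a b; clear; lra.
rewrite leqNgt; apply/negP => h.
have : mstart n <= M%:Z - 1.
  rewrite /mstart ceil_le_int ler_pdivrMr // rmorphB /= -pmulrn.
  have : ((4 * n)%N%:R : rat) <= (9 * M + 2)%N%:R by rewrite ler_nat -ltnS -addnS.
  by rewrite natrD !natrM; move: (n%:R : rat) (M%:R : rat) => a b; clear; lra.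
by rewrite ME; lia.
Qed.

Lemma start_value n M (v : int) : (n %/ 3 <= M)%N ->
  v%:~R = 3 * binz2 (M%:Z + 1) + 3 * binz2 (M%:Z + 1 - (n %/ 3)%N%:Z)
    - 3 * (M%:Z - (n %/ 3)%N%:Z)%:~R * (n%:R / 3 - (n %/ 3)%N%:R) :> rat ->
  v = (3 * 'C(M.+1, 2) + excess n M)%N%:Z.
Proof.
move=> hM vE; apply/eqP; rewrite -(eqr_int rat) vE /binz2; apply/eqP.
have -> : absz (M%:Z + 1)%R = M.+1 by lia.
have -> : absz (M%:Z + 1 - (n %/ 3)%N%:Z)%R = (M.+1 - n %/ 3)%N by lia.
have := congr1 (fun i : nat => i%:R : rat) (excess_closed hM).
have h3 : (3 * (n %/ 3) <= n)%N by lia.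
rewrite -!pmulrn !natrD !natrM !natrB // !natrM rmorphB /= -!pmulrn.
move: ('C(_, _)%:R : rat) ('C(_, _)%:R : rat) ((excess _ _)%:R : rat) (M%:R : rat) (n%:R : rat)
  ((n %/ 3)%:R : rat) => a b c d e f; clear; lra.
Qed.

Lemma le_half_sub K n : ((K%:Z - 1)%:~R <= (n%:R - 3) / 2 :> rat) = (2 * K < n)%N.
Proof.
rewrite ler_pdivlMr // rmorphB /= -pmulrn -(ler_nat rat) -[(2 * K).+1]addn1 natrD natrM.
by move: (n%:R : rat) (K%:R : rat) => a b; clear; apply/idP/idP => h; lra.
Qed.

Lemma ceil_step_le n K (a z : int) : (2 * K < n)%N ->
  'C(n, 2)%:Z + (n - 2 * K - 1)%N%:Z * a <= (n - 2 * K)%N%:Z * z ->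
  Num.ceil (1 / (n%:R - 2 * (K%:Z - 1)%:~R - 2)
    * ('C(n, 2)%:R + (n%:R - 2 * (K%:Z - 1)%:~R - 3) * a%:~R) : rat) <= z.
Proof.
move=> K2 h; rewrite -(ler_int rat) in h.
have hK : ((2 * K + 1)%N%:R : rat) <= n%:R by rewrite ler_nat addn1.
rewrite ceil_le_int mul1r mulrC ler_pdivrMr.
  have k1 : (2 * K <= n)%N by lia.
  have k2 : (1 <= n - 2 * K)%N by lia.
  move: h; rewrite rmorphD /= !rmorphM /= -!pmulrn (natrB _ k2) (natrB _ k1) natrM.
  rewrite rmorphB /= -pmulrn.
  move: (n%:R : rat) (K%:R : rat) (a%:~R : rat) (z%:~R : rat) ('C(_, _)%:R : rat) => p q r s t.
  by clear => h; lra.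
move: hK; rewrite natrD natrM rmorphB /= -pmulrn.
by move: (n%:R : rat) (K%:R : rat) => p q; clear; lra.
Qed.

Theorem theorem2 (R : realType) (n : nat) (u : int -> int) :
  (0 < n)%N ->
  (u (mstart n - 1))%:~R =
      3 * binz2 (mstart n + 1) + 3 * binz2 (mstart n + 1 - (n %/ 3)%N%:Z)
      - 3 * (mstart n - (n %/ 3)%N%:Z)%:~R * (n%:R / 3 - (n %/ 3)%N%:R) :> rat ->
  (forall j : int, mstart n <= j -> j%:~R <= (n%:R - 3) / 2 :> rat ->
     u j = Num.ceil (1 / (n%:R - 2 * j%:~R - 2)
                     * ('C(n, 2)%:R + (n%:R - 2 * j%:~R - 3) * (u (j - 1))%:~R)
                     : rat)) ->
  forall k : int, mstart n - 1 <= k -> k%:~R <= (n%:R - 3) / 2 :> rat ->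
    u k <= (Ele_min R n k)%:Z.
Proof.
move=> n0 u0 urec k mk kn.
rewrite /Ele_min; case: ex_minnP => e /asboolP[P [cP gp <-]] _ {e}.
have [M ME] : exists M : nat, mstart n = M%:Z by exists `|mstart n|%N; have := mstart_ge0 n0; lia.
have [Mlo Mhi] := mstart_bounds ME.
have hM : (n %/ 3 <= M)%N by have := mstart_ge3 n0; rewrite ME lez_nat.
rewrite ME in mk u0 urec; have uM := start_value hM u0.
pose U := few_edges P.
have K1 K : (2 * K < n)%N -> Ele (K%:Z - 1) P = U K.
  by move=> K2; rewrite Ele_few_edges // cP.
have uU : forall K, (M <= K)%N -> (2 * K < n)%N -> u (K%:Z - 1) <= (U K)%:Z.
  apply: (@recursion_bound n M (fun K => u (K%:Z - 1)) U) => [M2|M3|K z MK K2 h|K K0 K2].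
  - by rewrite uM lez_nat -cP; apply: few_edges_lb => //; rewrite cP.
  - by rewrite uM -PoszD lez_nat; apply: start_gap.
  - rewrite urec ?le_half_sub //; last by lia.
    have e : K.-1%:Z - 1 = K%:Z - 1 - 1 by lia.
    by apply: ceil_step_le => //; rewrite -e.
  - by have := @few_edges_step _ P gp K K0; rewrite cP; apply.
have [K kE] : exists K : nat, k = K%:Z - 1 by exists (absz (k + 1)%R); have := mstart_ge0 n0; lia.
have K2 : (2 * K < n)%N by rewrite -le_half_sub -kE.
by rewrite kE K1 // uU //; lia.
Qed.
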